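(* Let $T>0$ and $0<k<1$, let $u_h^0,u_h^1\in V_h$ be given, and let $(u_h^{n+1},p_h^{n+1})\in V_h\times Q_h$, $n\ge1$, satisfy the fully implicit BDF2 scheme $$1.5(u_h^{n+1},v_h)+k\nu(\nabla u_h^{n+1},\nabla v_h)+k(\mathrm{NL}(u_h^{n+1},u_h^{n+1}),v_h)-k(\nabla\cdot v_h,p_h^{n+1})=(2u_h^n-0.5u_h^{n-1},v_h)+k(f^{n+1},v_h)\quad\forall v_h\in V_h,$$ $$(\nabla\cdot u_h^{n+1},q_h)=0\quad\forall q_h\in Q_h.$$ Then, whether or not the finite element pair is divergence free (i.e. whether or not $\nabla\cdot V_h\subset Q_h$), for every $2\le n\le\lfloor T/k\rfloor$, $$\|u_h^n\|_{L^2(\Omega)}^2+\|2u_h^n-u_h^{n-1}\|_{L^2(\Omega)}^2\le\exp\Big(\frac{T}{1-k}\Big)\Big(\|u_h^1\|_{L^2(\Omega)}^2+\|2u_h^1-u_h^0\|_{L^2(\Omega)}^2+4k\sum_{j=2}^n\|f^j\|_{L^2(\Omega)}^2\Big).$$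
   Context: $\Omega\subset\mathbb{R}^3$ is a bounded domain; $(\cdot,\cdot)$ is the $L^2(\Omega)$ inner product. $V_h\subset[H_0^1(\Omega)]^3$ and $Q_h\subset\{q\in L^2(\Omega):\int_\Omega q\,dx=0\}$ are conforming mixed finite element (finite-dimensional) spaces satisfying the inf-sup condition $\inf_{0\ne q\in Q_h}\sup_{0\ne v\in V_h}\frac{(\nabla\cdot v,q)}{\|q\|_{L^2}\|\nabla v\|_{L^2}}>0$. $\nu>0$ is the viscosity, $k$ the time step size, $t_n=nk$, and $f^n=f(t_n)\in[L^2(\Omega)]^3$ the force at time $t_n$. The skew-symmetric convection form is $\mathrm{NL}(u,v)=(u\cdot\nabla)v+\frac12(\nabla\cdot u)v$. *)

(* Defs.v *)
From mathcomp Require Import all_boot all_order all_algebra.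
From mathcomp Require Import all_classical all_reals all_analysis.
Set Implicit Arguments.
Unset Strict Implicit.
Unset Printing Implicit Defensive.
Import Order.TTheory GRing.Theory Num.Theory.
Import numFieldNormedType.Exports.
Local Open Scope classical_set_scope.
Local Open Scope ring_scope.

(* As an iterated product, R^3 inherits both a normed space structure (for the
   max norm) and a Borel measurable structure from the library. *)
Notation space3 R := (R * R * R)%type.

(* Fields are total functions on R^3; only their values on the domain Omega
   matter, and those only up to negligible sets.  A vector field is the family
   of its components. *)
Notation sfield R := (space3 R -> R).
Notation vfield R := ('I_3 -> space3 R -> R).

Definition leb3 {R : realType} :
    {measure set (measurableTypeR R * measurableTypeR R * measurableTypeR R)
      -> \bar R} :=
  ((@lebesgue_measure R \x @lebesgue_measure R) \x @lebesgue_measure R)%E.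

Definition domain3 {R : realType} (Omega : set (space3 R)) : Prop :=
  [/\ Omega !=set0, open Omega & connected Omega].

Definition L2 {R : realType} (Omega : set (space3 R)) : set (sfield R) :=
  [set f | (f \_ Omega) \in Lfun leb3 2%:E].

Definition L2dot {R : realType} (Omega : set (space3 R)) (f g : sfield R) : R :=
  \int[leb3]_(x in Omega) (f x * g x).

Definition L2norm {R : realType} (Omega : set (space3 R)) (f : sfield R) : R :=
  Num.sqrt (L2dot Omega f f).

(* Products and norms of fields with components indexed by I: vector fields
   (I = 'I_3) and matrix fields (I = 'I_3 * 'I_3, Frobenius product). *)
Definition L2dotv {R : realType} (I : finType) (Omega : set (space3 R))
    (u v : I -> sfield R) : R :=
  \sum_(i : I) L2dot Omega (u i) (v i).

Definition L2normv {R : realType} (I : finType) (Omega : set (space3 R))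
    (u : I -> sfield R) : R :=
  Num.sqrt (L2dotv Omega u u).

Definition e3 {R : realType} (i : 'I_3) : space3 R :=
  ((i == 0%N :> nat)%:R, (i == 1%N :> nat)%:R, (i == 2%N :> nat)%:R).

Definition pderiv {R : realType} (i : 'I_3) (f : sfield R) : sfield R :=
  fun x => 'D_(e3 i) f x.

(* C^oo: iterated partial derivatives of all orders exist and are continuous. *)
Definition smooth3 {R : realType} (f : sfield R) : Prop :=
  forall s : seq 'I_3, let g := foldr pderiv f s in
    continuous g /\ forall (i : 'I_3) (x : space3 R), derivable g x (e3 i).

(* C_c^oo(Omega), each function being extended by zero to R^3. *)
Definition test_function {R : realType} (Omega : set (space3 R)) :
    set (sfield R) :=
  [set phi | [/\ smooth3 phi,
                 compact (closure [set x | phi x != 0])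
               & closure [set x | phi x != 0] `<=` Omega]].

Definition is_wderiv {R : realType} (Omega : set (space3 R)) (i : 'I_3)
    (u g : sfield R) : Prop :=
  L2 Omega g /\
  forall phi, test_function Omega phi ->
    L2dot Omega u (pderiv i phi) = - L2dot Omega g phi.

(* A representative of the weak derivative, which is unique only up to a
   negligible set; 0 if there is no weak derivative in L^2. *)
Definition wderiv {R : realType} (Omega : set (space3 R)) (i : 'I_3)
    (u : sfield R) : sfield R :=
  xget 0 [set g | is_wderiv Omega i u g].

Definition H1 {R : realType} (Omega : set (space3 R)) : set (sfield R) :=
  [set u | L2 Omega u /\ forall i, exists g, is_wderiv Omega i u g].

(* The closure of C_c^oo(Omega) in H^1(Omega). *)
Definition H10 {R : realType} (Omega : set (space3 R)) : set (sfield R) :=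
  [set u | H1 Omega u /\
    exists phi : nat -> sfield R,
      [/\ forall m, test_function Omega (phi m),
          L2norm Omega (u - phi m) @[m --> \oo] --> (0 : R)
        & forall i,
          L2norm Omega (wderiv Omega i u - pderiv i (phi m)) @[m --> \oo]
            --> (0 : R)]].

Definition grad {R : realType} (Omega : set (space3 R)) (u : vfield R) :
    'I_3 * 'I_3 -> sfield R :=
  fun ij => wderiv Omega ij.1 (u ij.2).

Definition div {R : realType} (Omega : set (space3 R)) (u : vfield R) :
    sfield R :=
  \sum_(i < 3) wderiv Omega i (u i).

Definition NL {R : realType} (Omega : set (space3 R)) (u v : vfield R) :
    vfield R :=
  fun j x => \sum_(i < 3) u i x * wderiv Omega i (v j) x
             + 2^-1 * div Omega u x * v j x.

Definition finite_dim_subspace {R : realType} (W : lmodType R) (V : set W) :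
    Prop :=
  exists (m : nat) (b : 'I_m -> W),
    V = [set w | exists c : 'I_m -> R, w = \sum_(j < m) c j *: b j].

(* Here "v <> 0" means nonzero as an element of L^2(Omega).  The infimum and
   supremum are taken in the extended reals. *)
Definition inf_sup {R : realType} (Omega : set (space3 R))
    (V : set (vfield R)) (Q : set (sfield R)) : Prop :=
  (0 < ereal_inf
    [set ereal_sup
      [set (L2dot Omega (div Omega v) q
            / (L2norm Omega q * L2normv Omega (grad Omega v)))%:E
      | v in [set v | V v /\ L2normv Omega v != 0%R]]
    | q in [set q | Q q /\ L2norm Omega q != 0%R]])%E.

Definition mixed_fem {R : realType} (Omega : set (space3 R))
    (V : set (vfield R)) (Q : set (sfield R)) : Prop :=
  [/\ finite_dim_subspace V, finite_dim_subspace Q,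
      V `<=` [set v | forall i, H10 Omega (v i)],
      Q `<=` [set q | L2 Omega q /\ \int[leb3]_(x in Omega) q x = 0]
    & inf_sup Omega V Q].

(* Main.v *)
(* Testing the momentum equation with [u n.+1] removes the pressure (by the
   discrete incompressibility) and the convection term (by skew-symmetry); the
   G-stability identity of BDF2 and Young's inequality then give
   (1 - k) E_(n+1) <= E_n + 4 k |f^(n+1)|^2, and 1 / (1 - k) <= exp (k / (1 - k))
   turns the iterated inequality into the claimed bound.
   Skew-symmetry holds in H^1_0 only because the cubic terms are integrable in
   dimension 3: Ladyzhenskaya's inequality for test functions, proved by slicing
   with Tonelli's theorem, makes the approximating test functions converge in
   L^4 as well, and the definition of the weak derivative, applied to the square
   of a test function, passes to the limit. *)

From HB Require Import structures.
Require Import Defs.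
From mathcomp Require Import all_boot all_order all_algebra.
From mathcomp Require Import all_classical all_reals all_analysis.
From mathcomp Require Import measurable_realfun.
From mathcomp Require Import ring lra.
Set Implicit Arguments.
Unset Strict Implicit.
Unset Printing Implicit Defensive.
Import Order.TTheory GRing.Theory Num.Theory.
Import numFieldNormedType.Exports.
Local Open Scope classical_set_scope.
Local Open Scope ring_scope.

(** * Square integrable functions *)

(** No regularity of the boundary is assumed, so no embedding theorem on [Omega] is at hand: the
    estimates are made on test functions, extended by zero to the whole space, and carried to H^1_0
    by density. L^2 convergence of the approximants does not control the cubic terms, hence the
    detour through L^4. The discrete velocity is divergence free only against [Q]: the integral of
    (u . grad w) w is that of -1/2 (div u) w^2, in general not zero, and the second half of [NL] is
    made to cancel it. The viscous term is nonnegative and is dropped, which is why [nu] is absent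
    from the bound. The rate 1/(1 - k) comes from the k |u^(n+1)|^2 that Young's inequality leaves
    and the left-hand side absorbs, at each of at most T/k steps. *)

Section square_integrable.
Context d (T : measurableType d) (R : realType).
Variables (mu : {measure set T -> \bar R}) (D : set T).
Hypothesis mD : measurable D.
Implicit Types f g h : T -> R.

(** Measurability of [f] is asked for separately: it does not follow from that of [f \* f]. *)
Definition sq_integrable f :=
  measurable_fun D f /\ mu.-integrable D (EFin \o (f \* f)).

Definition dot f g : R := \int[mu]_(x in D) (f x * g x).

Definition nrm f : R := Num.sqrt (dot f f).

Lemma le_sq_integrable f g : measurable_fun D f ->
  (forall x, D x -> f x ^+ 2 <= g x) ->
  mu.-integrable D (EFin \o g) -> sq_integrable f.
Proof.
move=> mf fg ig; split=> //; apply: le_integrable ig => //.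
  by apply/measurable_EFinP; apply: measurable_funM.
move=> x Dx; rewrite /= lee_fin -expr2 ger0_norm ?sqr_ge0//.
by rewrite (le_trans (fg _ Dx)) ?ler_norm.
Qed.

Lemma integrable_mul f g : sq_integrable f -> sq_integrable g ->
  mu.-integrable D (EFin \o (f \* g)).
Proof.
move=> [mf If] [mg Ig].
apply: (@le_integrable _ _ _ _ D mD _ (EFin \o ((f \* f) \+ (g \* g)))) => //.
- by apply/measurable_EFinP; apply: measurable_funM.
- move=> x Dx /=; rewrite lee_fin [leRHS]ger0_norm; last first.
    by rewrite addr_ge0// -expr2 sqr_ge0.
  rewrite ler_norml; apply/andP; split; nra.
- exact: (integrableD mD If Ig).
Qed.

Lemma sq_integrableD f g : sq_integrable f -> sq_integrable g ->
  sq_integrable (f \+ g).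
Proof.
move=> hf hg; have [mf If] := hf; have [mg Ig] := hg.
split; first exact: measurable_funD.
have -> : EFin \o ((f \+ g) \* (f \+ g)) =
  (EFin \o (f \* f)) \+ (EFin \o (f \* g)) \+
  ((EFin \o (f \* g)) \+ (EFin \o (g \* g))).
  by apply/funext => x /=; rewrite -!EFinD; congr EFin; ring.
by do ![apply: (integrableD mD) => //]; apply: integrable_mul.
Qed.

Lemma sq_integrableZ a f : sq_integrable f ->
  sq_integrable (fun x => a * f x).
Proof.
move=> [mf If]; split; first exact: measurable_funM.
have -> : EFin \o ((fun x => a * f x) \* (fun x => a * f x)) =
  (fun x => ((a ^+ 2)%:E * (EFin \o (f \* f)%R) x)%E).
  by apply/funext => x /=; rewrite -EFinM; congr EFin; ring.
exact: (integrableZl mD _ If).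
Qed.

Lemma sq_integrableB f g : sq_integrable f -> sq_integrable g ->
  sq_integrable (f \- g).
Proof.
move=> hf /(sq_integrableZ (-1)) hg.
have -> : f \- g = f \+ (fun x => -1 * g x).
  by apply/funext => x /=; rewrite mulN1r.
exact: sq_integrableD.
Qed.

Lemma sq_integrable_norm f : sq_integrable f -> sq_integrable (Num.norm \o f).
Proof.
move=> [mf If]; apply: (le_sq_integrable _ _ If); first exact: measurableT_comp.
by move=> x _ /=; rewrite real_normK// num_real.
Qed.

Lemma dotC f g : dot f g = dot g f.
Proof. by apply: eq_Rintegral => x _; rewrite mulrC. Qed.

Lemma dotDl f g h : sq_integrable f -> sq_integrable g -> sq_integrable h ->
  dot (f \+ g) h = dot f h + dot g h.
Proof.
move=> hf hg hh; rewrite /dot -RintegralD//; [|exact: integrable_mul..].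
by apply: eq_Rintegral => x _ /=; rewrite mulrDl.
Qed.

Lemma dotZl a f g : sq_integrable f -> sq_integrable g ->
  dot (fun x => a * f x) g = a * dot f g.
Proof.
move=> hf hg; rewrite /dot -RintegralZl//; last exact: integrable_mul.
by apply: eq_Rintegral => x _ /=; rewrite mulrA.
Qed.

Lemma dotBl f g h : sq_integrable f -> sq_integrable g -> sq_integrable h ->
  dot (f \- g) h = dot f h - dot g h.
Proof.
move=> hf hg hh; rewrite /dot -RintegralB//; [|exact: integrable_mul..].
by apply: eq_Rintegral => x _ /=; rewrite mulrBl.
Qed.

Lemma dot_ge0 f : 0 <= dot f f.
Proof. by apply: Rintegral_ge0 => x _; rewrite -expr2 sqr_ge0. Qed.

Lemma nrm_ge0 f : 0 <= nrm f.
Proof. exact: sqrtr_ge0. Qed.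

Lemma sqr_nrm f : nrm f ^+ 2 = dot f f.
Proof. by rewrite sqr_sqrtr// dot_ge0. Qed.

Lemma dot_sqr_le f g : sq_integrable f -> sq_integrable g ->
  dot f g ^+ 2 <= dot f f * dot g g.
Proof.
move=> hf hg.
have P t : 0 <= dot f f + 2 * t * dot f g + t ^+ 2 * dot g g.
  have htg := sq_integrableZ t hg.
  have hs := sq_integrableD hf htg.
  apply: le_trans (dot_ge0 (f \+ (fun x => t * g x))) _.
  rewrite dotDl// !(dotC _ (_ \+ _)) !dotDl// !(dotC _ (fun x => t * g x)).
  rewrite !dotZl// (dotC g (fun x => t * g x)) dotZl// (dotC g f).
  by rewrite le_eqVlt; apply/orP; left; apply/eqP; ring.
have A0 := dot_ge0 f; have C0 := dot_ge0 g.
have [C0'|Cn0] := eqVneq (dot g g) 0.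
  have [-> |Bn0] := eqVneq (dot f g) 0; first by rewrite expr0n /= mulr_ge0.
  (* With (g, g) = 0 the polynomial is affine in [t]; this value of [t] makes it -1. *)
  have := P (- (dot f f + 1) / (2 * dot f g)).
  rewrite C0' mulr0 addr0.
  have -> : 2 * (- (dot f f + 1) / (2 * dot f g)) * dot f g = - (dot f f + 1).
    by field.
  by lra.
have Cp : 0 < dot g g by rewrite lt_def Cn0.
have := P (- dot f g / dot g g).
have -> : dot f f + 2 * (- dot f g / dot g g) * dot f g +
  (- dot f g / dot g g) ^+ 2 * dot g g
  = (dot f f * dot g g - dot f g ^+ 2) / dot g g by field.
by rewrite pmulr_lge0 ?invr_gt0// subr_ge0.
Qed.

Lemma normr_dot_le f g : sq_integrable f -> sq_integrable g ->
  `|dot f g| <= nrm f * nrm g.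
Proof.
move=> hf hg; rewrite -[leRHS]ger0_norm ?mulr_ge0 ?nrm_ge0//.
by rewrite -ler_sqr ?nnegrE// !real_normK ?num_real// exprMn !sqr_nrm dot_sqr_le.
Qed.

Lemma nrmD f g : sq_integrable f -> sq_integrable g ->
  nrm (f \+ g) <= nrm f + nrm g.
Proof.
move=> hf hg; have hs := sq_integrableD hf hg.
rewrite -ler_sqr ?nnegrE ?addr_ge0 ?nrm_ge0// sqr_nrm dotDl//.
rewrite !(dotC _ (_ \+ _)) !dotDl// (dotC g f) sqrrD !sqr_nrm.
have := normr_dot_le hf hg; have := ler_norm (dot f g); lra.
Qed.

Lemma nrmB f g : sq_integrable f -> sq_integrable g ->
  nrm (f \- g) <= nrm f + nrm g.
Proof.
move=> hf hg; have hg' := sq_integrableZ (-1) hg.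
have -> : f \- g = f \+ (fun x => -1 * g x).
  by apply/funext => x /=; rewrite mulN1r.
apply: le_trans (nrmD hf hg') _; rewrite lerD2l /nrm.
by under [dot _ _]eq_Rintegral do rewrite !mulN1r mulrNN.
Qed.

Lemma nrm_subC f g : nrm (f \- g) = nrm (g \- f).
Proof.
by congr Num.sqrt; apply: eq_Rintegral => x _ /=; ring.
Qed.

(** The space L^4(D), phrased so that the L^2 calculus applies to products of two such functions. *)
Definition quartic f := measurable_fun D f /\ sq_integrable (f \* f).

Lemma quartic_mul f g : quartic f -> quartic g -> sq_integrable (f \* g).
Proof.
move=> [mf hf] [mg hg]; split; first exact: measurable_funM.
have -> : (f \* g) \* (f \* g) = (f \* f) \* (g \* g).
  by apply/funext => x /=; ring.
exact: integrable_mul.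
Qed.

Lemma nrm_mul_sqr_le f g : quartic f -> quartic g ->
  nrm (f \* g) ^+ 2 <= nrm (f \* f) * nrm (g \* g).
Proof.
move=> [mf hf] [mg hg].
apply: le_trans (normr_dot_le hf hg); apply: le_trans (ler_norm _).
rewrite sqr_nrm le_eqVlt; apply/orP; left; apply/eqP.
by apply: eq_Rintegral => x _ /=; ring.
Qed.

(** [Num.sqrt (nrm (h \* h))] is the L^4 norm of [h], so this is Hoelder's inequality; it comes from
    Cauchy-Schwarz applied to f^2 and g^2. *)
Lemma nrm_mul_le f g : quartic f -> quartic g ->
  nrm (f \* g) <= Num.sqrt (nrm (f \* f)) * Num.sqrt (nrm (g \* g)).
Proof.
move=> hf hg; rewrite -ler_sqr ?nnegrE ?mulr_ge0 ?nrm_ge0 ?sqrtr_ge0//.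
by rewrite exprMn (sqr_sqrtr (nrm_ge0 (f \* f))) (sqr_sqrtr (nrm_ge0 (g \* g)))
  nrm_mul_sqr_le.
Qed.

Lemma quarticB f g : quartic f -> quartic g -> quartic (f \- g).
Proof.
move=> hf hg; have [mf If] := hf; have [mg Ig] := hg.
split; first exact: measurable_funB.
have -> : (f \- g) \* (f \- g) = (f \* f \- f \* g) \- (f \* g \- g \* g).
  by apply/funext => x /=; ring.
by do ![apply: sq_integrableB => //]; apply: quartic_mul.
Qed.

Lemma cvg_dot (f_ g_ : nat -> T -> R) f g :
  (forall n, sq_integrable (f_ n)) -> (forall n, sq_integrable (g_ n)) ->
  sq_integrable f -> sq_integrable g ->
  nrm (f_ n \- f) @[n --> \oo] --> (0 : R) ->
  nrm (g_ n \- g) @[n --> \oo] --> (0 : R) ->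
  dot (f_ n) (g_ n) @[n --> \oo] --> dot f g.
Proof.
move=> hf_ hg_ hf hg cf cg.
have hfB n : sq_integrable (f_ n \- f) by exact: sq_integrableB.
have hgB n : sq_integrable (g_ n \- g) by exact: sq_integrableB.
have E n : dot (f_ n) (g_ n) - dot f g =
  dot (f_ n \- f) (g_ n \- g) + dot (f_ n \- f) g + dot f (g_ n \- g).
  rewrite !dotBl// !(dotC _ (_ \- _)) !dotBl// !(dotC (g_ n)) !(dotC g).
  ring.
apply/cvgrPdist_le => e e0 /=.
have cv : nrm (f_ n \- f) * nrm (g_ n \- g) + nrm (f_ n \- f) * nrm g
  + nrm f * nrm (g_ n \- g) @[n --> \oo] --> (0 * 0 + 0 * nrm g + nrm f * 0 : R).
  apply: cvgD; [apply: cvgD|]; [exact: cvgM| |]; apply: cvgM => //; exact: cvg_cst.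
move: cv; rewrite !mul0r mulr0 !addr0 => /cvgrPdist_le/(_ _ e0) /=.
apply: filterS => n; rewrite sub0r normrN distrC E; apply: le_trans.
apply: le_trans (ler_norm _).
rewrite (le_trans (ler_normD _ _))// lerD ?normr_dot_le//.
by rewrite (le_trans (ler_normD _ _))// lerD ?normr_dot_le.
Qed.

(** The two limits assumed are convergence in L^4; the difference of the products is split into
    three products, each with a small factor. *)
Lemma cvg_nrm_mul (f_ g_ : nat -> T -> R) f g :
  (forall n, quartic (f_ n)) -> (forall n, quartic (g_ n)) ->
  quartic f -> quartic g ->
  nrm ((f_ n \- f) \* (f_ n \- f)) @[n --> \oo] --> (0 : R) ->
  nrm ((g_ n \- g) \* (g_ n \- g)) @[n --> \oo] --> (0 : R) ->
  nrm ((f_ n \* g_ n) \- (f \* g)) @[n --> \oo] --> (0 : R).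
Proof.
move=> hf_ hg_ hf hg cf cg.
have hfB n : quartic (f_ n \- f) by exact: quarticB.
have hgB n : quartic (g_ n \- g) by exact: quarticB.
have s0 (a : nat -> R) : a n @[n --> \oo] --> (0 : R) ->
    Num.sqrt (a n) @[n --> \oo] --> (0 : R).
  move=> ca; rewrite -[X in _ --> X]sqrtr0.
  by apply: continuous_cvg => //; exact: sqrt_continuous.
have {}cf := s0 _ cf; have {}cg := s0 _ cg.
pose q h := Num.sqrt (nrm (h \* h)).
have cv : q (f_ n \- f) * q (g_ n \- g) + q (f_ n \- f) * q g
  + q f * q (g_ n \- g) @[n --> \oo] --> (0 * 0 + 0 * q g + q f * 0 : R).
  apply: cvgD; [apply: cvgD|]; [exact: cvgM| |]; apply: cvgM => //; exact: cvg_cst.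
apply/cvgrPdist_le => e e0 /=.
move: cv; rewrite !mul0r mulr0 !addr0 => /cvgrPdist_le/(_ _ e0) /=.
apply: filterS => n; rewrite !sub0r !normrN; apply: le_trans.
apply: le_trans (ler_norm _); rewrite ger0_norm ?nrm_ge0//.
have -> : (f_ n \* g_ n) \- (f \* g) = ((f_ n \- f) \* (g_ n \- g)
  \+ (f_ n \- f) \* g) \+ f \* (g_ n \- g) by apply/funext => x /=; ring.
have h1 : sq_integrable ((f_ n \- f) \* (g_ n \- g)) by exact: quartic_mul.
have h2 : sq_integrable ((f_ n \- f) \* g) by exact: quartic_mul.
have h3 : sq_integrable (f \* (g_ n \- g)) by exact: quartic_mul.
rewrite (le_trans (nrmD _ _)) ?lerD ?nrm_mul_le//; first exact: sq_integrableD.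
by rewrite (le_trans (nrmD _ _)) ?lerD ?nrm_mul_le.
Qed.

Lemma ge0_integral_fin f : measurable_fun D f -> (forall x, D x -> 0 <= f x) ->
  (\int[mu]_(x in D) (f x)%:E < +oo)%E -> mu.-integrable D (EFin \o f).
Proof.
move=> mf f0 fi; apply/integrableP; split; first exact/measurable_EFinP.
under eq_integral => x /set_mem Dx do rewrite gee0_abs ?lee_fin ?f0//.
exact: fi.
Qed.

(* Fatou's lemma would need an almost everywhere convergent subsequence; the
   truncations [min (s ^+ 2) M] are Lipschitz in s ^+ 2, so convergence in L^2
   passes to them directly, and then M tends to infinity. *)
Lemma quartic_lim (f_ : nat -> T -> R) f (C : R) :
  (forall n, sq_integrable (f_ n)) -> sq_integrable f ->
  nrm (f_ n \- f) @[n --> \oo] --> (0 : R) ->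
  (\forall n \near \oo, quartic (f_ n) /\ nrm (f_ n \* f_ n) ^+ 2 <= C) ->
  quartic f /\ nrm (f \* f) ^+ 2 <= C.
Proof.
move=> hf_ hf cf hC; have [mf If] := hf.
have mff : measurable_fun D (f \* f) by exact: measurable_funM.
have f20 x : 0 <= f x * f x by rewrite -expr2 sqr_ge0.
pose t (M : nat) x := Num.min (f x * f x) M%:R.
have t0 M x : 0 <= t M x by rewrite le_min f20 ler0n.
have tM M x : t M x <= M%:R by rewrite ge_min lexx orbT.
have tf M x : t M x <= f x * f x by rewrite ge_min lexx.
have mt M : measurable_fun D (t M).
  by apply: measurable_minr => //; exact: measurable_cst.
have ht M : sq_integrable (t M).
  apply: (@le_sq_integrable _ (fun x => M%:R * (f x * f x))) => //.
    by move=> x _; rewrite expr2 ler_pM.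
  exact: (integrableZl mD M%:R If).
have bt M : dot (t M) (t M) <= C.
  (* [F n] results from integrating min(f^2, M)^2 <= f_n^4 + 2 M |f^2 - f_n^2|, where |f^2 - f_n^2|
     <= 2 |f_n - f| |f| + (f_n - f)^2, and applying Cauchy-Schwarz. *)
  pose F n := C + 2 * M%:R * (2 * (nrm (f_ n \- f) * nrm f)
                   + nrm (f_ n \- f) * nrm (f_ n \- f)).
  have cF : F n @[n --> \oo] --> C + 2 * M%:R * (2 * (0 * nrm f) + 0 * 0).
    apply: cvgD; first exact: cvg_cst.
    apply: cvgM; first exact: cvg_cst.
    apply: cvgD; last exact: cvgM.
    apply: cvgM; first exact: cvg_cst.
    by apply: cvgM => //; exact: cvg_cst.
  rewrite !mul0r mulr0 addr0 mulr0 addr0 in cF.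
  apply: (ler_cvg_to (cvg_cst _) cF).
  apply: filterS hC => n [[mfn qfn]]; rewrite sqr_nrm => Cn.
  have hd : sq_integrable (f_ n \- f) by exact: sq_integrableB.
  have had := sq_integrable_norm hd; have haf := sq_integrable_norm hf.
  have nabs h : nrm (Num.norm \o h) = nrm h.
    congr Num.sqrt; apply: eq_Rintegral => x _ /=.
    by rewrite -!expr2 real_normK// num_real.
  have i1 := integrable_mul qfn qfn.
  have i2 := integrable_mul had haf.
  have i3 := integrable_mul hd hd.
  have i23 : mu.-integrable D (EFin \o (fun x =>
      2 * (((Num.norm \o (f_ n \- f)) \* (Num.norm \o f)) x) +
      ((f_ n \- f) \* (f_ n \- f)) x)).
    exact: (integrableD mD (integrableZl mD 2 i2) i3).
  have i4 := integrableZl mD (2 * M%:R) i23.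
  apply: (@le_trans _ _ (\int[mu]_(x in D) ((f_ n \* f_ n) x * (f_ n \* f_ n) x +
     2 * M%:R * (2 * (((Num.norm \o (f_ n \- f)) \* (Num.norm \o f)) x) +
      ((f_ n \- f) \* (f_ n \- f)) x)))).
    apply: le_Rintegral => //; first exact: integrable_mul.
      exact: (integrableD mD i1 i4).
    move=> x _ /=; set a := f x; set b := f_ n x.
    rewrite /t -/a.
    have d1 : `|a * a - b * b| <= 2 * (`|b - a| * `|a|) + (b - a) * (b - a).
      have -> : a * a - b * b = - (2 * ((b - a) * a)) - (b - a) * (b - a) by ring.
      rewrite (le_trans (ler_normB _ _))// normrN 2!normrM ger0_norm//.
      by rewrite [X in _ + X <= _]ger0_norm// -expr2 sqr_ge0.
    have a0 : 0 <= a * a by rewrite -expr2 sqr_ge0.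
    have b0 : 0 <= b * b by rewrite -expr2 sqr_ge0.
    move: d1 a0 b0 (ler0n R M); set A := a * a; set B := b * b.
    set E := 2 * _ + _; set m := M%:R.
    rewrite ler_norml => /andP[d1 d2] A0 B0 m0.
    by case: (leP A m) => ?; case: (leP A B) => ?; case: (leP B m) => ?; nra.
  rewrite RintegralD// RintegralZl// RintegralD//; last exact: (integrableZl mD 2 i2).
  rewrite RintegralZl// lerD// ler_wpM2l ?mulr_ge0//.
  rewrite lerD//; last by rewrite -expr2 sqr_nrm.
  rewrite ler_wpM2l// (le_trans (ler_norm _))//.
  by rewrite (le_trans (normr_dot_le had haf))// !nabs.
have g0 M x : D x -> (0 <= (t M x * t M x)%:E)%E.
  by move=> _; rewrite lee_fin mulr_ge0.
have gnd x : D x -> {homo (fun M => (t M x * t M x)%:E) : n m / (n <= m)%N >-> (n <= m)%E}.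
  move=> _ n m nm; rewrite lee_fin.
  suff : t n x <= t m x by move=> ?; rewrite ler_pM.
  by rewrite le_min tf (le_trans (tM _ _))// ler_nat.
have mg M : measurable_fun D (fun x => (t M x * t M x)%:E).
  by apply/measurable_EFinP; exact: measurable_funM.
have := @cvg_monotone_convergence _ _ _ mu _ mD _ mg g0 gnd.
have limE x : limn (fun M => (t M x * t M x)%:E) = ((f \* f) x * (f \* f) x)%:E.
  apply/cvg_lim => //; apply: cvg_near_cst.
  exists (Num.trunc (f x * f x)).+1 => // M /= hM; rewrite /t min_l//.
  rewrite (le_trans (ltW (truncnS_gt (f x * f x))))// ler_nat//.
rewrite /= (funext limE) => cv.
have fin : (\int[mu]_(x in D) ((f \* f) x * (f \* f) x)%:E <= C%:E)%E.
  rewrite -(cvg_lim _ cv)//; apply: lime_le.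
    by apply/cvg_ex; eexists; exact: cv.
  apply: nearW => M.
  have := integrable_fin_num mD (ht M).2 => /fineK <-.
  by rewrite lee_fin; exact: bt.
have sff : sq_integrable (f \* f).
  split => //; apply: ge0_integral_fin => //; first exact: measurable_funM.
    by move=> x _ /=; rewrite mulr_ge0.
  by apply: le_lt_trans fin _; rewrite ltry.
split => //; rewrite sqr_nrm -lee_fin.
apply: le_trans fin; rewrite /dot /Rintegral fineK//.
exact: (integrable_fin_num mD sff.2).
Qed.

End square_integrable.

(** * Ladyzhenskaya's inequality *)

Notation mspace3 R :=
  (measurableTypeR R * measurableTypeR R * measurableTypeR R)%type.

(** The sigma-algebra is the product one and the topology that of the max norm, so the two have to
    be compared: an open set is the union of the countably many boxes with rational centres and
    radii 1/(n+1) that it contains. *)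
Lemma open_measurable3 (R : realType) (U : set (space3 R)) :
  open U -> measurable (U : set (mspace3 R)).
Proof.
move=> oU.
pose box (i : rat * rat * rat * nat) : set (space3 R) :=
  (ball (ratr i.1.1.1 : R) (i.2.+1%:R^-1 : R) `*`
   ball (ratr i.1.1.2 : R) (i.2.+1%:R^-1 : R)) `*`
   ball (ratr i.1.2 : R) (i.2.+1%:R^-1 : R).
pose B i := if `[< box i `<=` U >] then box i else set0.
have -> : U = \bigcup_i B i.
  apply/seteqP; split; last first.
    by move=> x [i _]; rewrite /B; case: asboolP => // + ; apply.
  move=> [[x y] z] Ux.
  have /nbhs_ballP[e /= e0 eU] : nbhs ((x, y), z) U by exact: open_nbhs_nbhs.
  (* Twice the radius must be at most [e]: the box is centred at rationals within one radius of the
     point, not at the point. *)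
  pose n := Num.trunc (2 / e).
  have n0 : (0 : R) < n.+1%:R^-1 by rewrite invr_gt0 ltr0n.
  have ne : n.+1%:R^-1 + n.+1%:R^-1 <= e.
    have := truncnS_gt (2 / e); rewrite -/n => h.
    rewrite -mulr2n -[leLHS]mulr_natl ler_pdivrMr ?ltr0n// mulrC -ler_pdivrMr//; exact: ltW.
  have dr (t : R) : exists q : rat, ball t (n.+1%:R^-1 : R) (ratr q : R).
    have [||r [tr [q _ qr]]] := @dense_rat R (ball t (n.+1%:R^-1 : R)).
    - by exists t; exact: ballxx.
    - exact: ball_open.
    - by exists q; rewrite qr.
  have [qx hx] := dr x; have [qy hy] := dr y; have [qz hz] := dr z.
  exists (qx, qy, qz, n) => //; rewrite /B asboolT.
    by rewrite /box /=; do ![split] => /=; exact: ball_sym.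
  move=> [[x' y'] z'] [[/= hx' hy'] hz']; apply: eU.
  do ![split] => /=; apply: (le_ball ne).
  - exact: ball_triangle hx hx'.
  - exact: ball_triangle hy hy'.
  - exact: ball_triangle hz hz'.
apply: countable_bigcupT_measurable => // i; rewrite /B.
case: asboolP => _; last exact: measurable0.
have mb (t : R) r : measurable (ball t r : set (measurableTypeR R)).
  exact: open_measurable (ball_open _ _).
by apply: measurableX => //; exact: measurableX.
Qed.

Lemma continuous_measurable3 (R : realType) (f : space3 R -> R) :
  continuous f -> measurable_fun (setT : set (mspace3 R)) (f : mspace3 R -> R).
Proof.
move=> /continuousP cf.
apply: (measurability _ (RGenOpens.measurableE R)) => _ [_ [a [b ->] <-]].
rewrite setTI; apply: open_measurable3; exact/cf/interval_open.
Qed.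

(** Squared and in the extended reals, because it is applied to slices before any integral is known
    to be finite. *)
Lemma ge0_ereal_cauchy_schwarz d (T : measurableType d) (R : realType)
    (mu : {measure set T -> \bar R}) (f g : T -> R) :
  measurable_fun setT f -> measurable_fun setT g ->
  (\int[mu]_x (`|f x * g x|)%:E * \int[mu]_x (`|f x * g x|)%:E <=
   \int[mu]_x (f x ^+ 2)%:E * \int[mu]_x (g x ^+ 2)%:E)%E.
Proof.
move=> mf mg.
have := @hoelder _ _ _ mu f g 2 2 mf mg.
move=> /(_ ltac:(lra) ltac:(lra) ltac:(lra)).
rewrite Lnorm1 => h.
have n2 (u : T -> R) : (('N[mu]_2%:E[EFin \o u] * 'N[mu]_2%:E[EFin \o u]) =
    \int[mu]_x (u x ^+ 2)%:E)%E.
  rewrite unlock /Lnorm.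
  have -> : (\int[mu]_x `|(EFin \o u) x| `^ 2)%E = (\int[mu]_x (u x ^+ 2)%:E)%E.
    by apply: eq_integral => x _ /=; rewrite powR_mulrn// real_normK// num_real.
  have u0 : (0 <= \int[mu]_x (u x ^+ 2)%:E)%E.
    by apply: integral_ge0 => x _; rewrite lee_fin sqr_ge0.
  have e1 : (2^-1 + 2^-1 = 1 :> R)%R by rewrite [RHS]splitr !div1r.
  rewrite -poweRD; last by apply: add_neq0_poweRD_def; rewrite e1 oner_neq0.
  by rewrite e1 poweRe1.
rewrite -(n2 f) -(n2 g) muleACA.
by apply: lee_pmul => //; apply: integral_ge0.
Qed.

(** The fundamental theorem of calculus for g^2 on [a, x]. The integral is then enlarged to the
    whole line, so that the bound no longer depends on [x]. *)
Lemma sqr_le_integral (R : realType) (g dg : R -> R) (a x : R) : a < x -> g a = 0 ->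
  (forall t : R, is_derive t (1 : R) g (dg t)) -> continuous dg ->
  ((g x ^+ 2)%:E <= \int[@lebesgue_measure R]_t (`|2 * (g t * dg t)|)%:E)%E.
Proof.
move=> ax ga0 dgP cdg.
have cg : continuous g.
  by move=> t; apply: differentiable_continuous; apply/derivable1_diffP; case: (dgP t).
pose h t := 2 * (g t * dg t).
have ch : continuous h.
  move=> t; apply: cvgM; first exact: cvg_cst.
  by apply: cvgM; [exact: cg|exact: cdg].
have dG (t : R) : is_derive t (1 : R) (g ^+ 2) (h t).
  have := dgP t => dgt.
  by apply: is_derive_eq; rewrite /h /GRing.scale /=; ring.
have mh : measurable_fun setT (fun t => (`|h t|)%:E).
  apply/measurable_EFinP; apply: measurableT_comp => //.
  exact: continuous_measurable_fun.
have E : (\int[@lebesgue_measure R]_(t in `[a, x]) (h t)%:E =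
    ((g ^+ 2) x)%:E - ((g ^+ 2) a)%:E)%E.
  apply: continuous_FTC2 => //.
  - by apply: continuous_subspaceT.
  - have cg2 : continuous (g ^+ 2).
      by move=> t; apply: differentiable_continuous; apply/derivable1_diffP; case: (dG t).
    split; first by move=> t _; case: (dG t).
      exact: cvg_at_right_filter (cg2 a).
    exact: cvg_at_left_filter (cg2 x).
  - by move=> t _; rewrite derive1E; have [_ ->] := dG t.
have : (\int[@lebesgue_measure R]_(t in `[a, x]) (h t)%:E = (g x ^+ 2)%:E)%E.
  by rewrite E /= !fctE ga0 expr0n /= sube0.
move=> <-.
apply: (@le_trans _ _ (\int[@lebesgue_measure R]_(t in `[a, x]) (`|h t|)%:E)%E).
  apply: le_trans (lee_abs _) _.
  apply: le_trans; first apply: le_abse_integral => //.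
    apply/measurable_EFinP; apply: measurable_funTS.
    exact: continuous_measurable_fun.
  by [].
by apply: ge0_subset_integral => //; exact: measurable_itv.
Qed.

Lemma continuous_pair (T U V : topologicalType) (f : T -> U) (g : T -> V) :
  continuous f -> continuous g -> continuous (fun t => (f t, g t)).
Proof. by move=> cf cg t; exact: (cvg_pair (cf t) (cg t)). Qed.

(* The library's instance of [\x] as a sigma-finite measure is shadowed by the
   one for subprobability measures; the wrapper restores it. *)
Definition leb2 {R : realType}
    : set (measurableTypeR R * measurableTypeR R) -> \bar R :=
  (@lebesgue_measure R \x @lebesgue_measure R)%E.

HB.instance Definition _ (R : realType) := Measure.on (@leb2 R).

Lemma sigma_finite_leb2 (R : realType) : sigma_finite setT (@leb2 R).
Proof.
pose I n : set (measurableTypeR R) := `[- n%:R, n%:R]%classic.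
exists (fun n => I n `*` I n).
  rewrite predeqE => -[x y]; split=> // _.
  exists (Num.trunc (Num.max `|x| `|y|)).+1 => //.
  have := truncnS_gt (Num.max `|x| `|y|).
  rewrite gt_max => /andP[/ltW hx /ltW hy].
  by rewrite /I; split; rewrite /= in_itv /= -ler_norml.
have mI n : measurable (I n) by exact: measurable_itv.
move=> n; split; first by apply: measurableX; exact: mI.
have fI : (@lebesgue_measure R (I n) < +oo)%E.
  by rewrite lebesgue_measure_itv /=; case: ifP => _; rewrite -?EFinB ltry.
rewrite /leb2 product_measure1E; [|exact: mI..]; apply: lte_mul_pinfty => //.
by rewrite ge0_fin_numE.
Qed.

HB.instance Definition _ (R : realType) :=
  Measure_isSigmaFinite.Build _ _ _ (@leb2 R) (sigma_finite_leb2 R).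

(** * Slicing the space into planes and lines *)

Section ladyzhenskaya.
Local Open Scope ereal_scope.
Variable R : realType.
Notation leb := (@lebesgue_measure R).
Notation leb2 := (@leb2 R).

(** The arguments are crossed as in the use made of it: integrating out x leaves a function of y,
    and conversely. *)
Lemma integral_prod_mul (F1 F2 : measurableTypeR R -> \bar R) :
  measurable_fun setT F1 -> measurable_fun setT F2 ->
  (forall x, 0 <= F1 x) -> (forall x, 0 <= F2 x) ->
  \int[leb2]_p (F1 p.2 * F2 p.1) = (\int[leb]_y F1 y) * \int[leb]_x F2 x.
Proof.
move=> mF1 mF2 F10 F20.
rewrite fubini_tonelli1/=; last 2 first.
- by apply: emeasurable_funM; apply: measurableT_comp.
- by move=> p; rewrite mule_ge0.
rewrite -ge0_integralZl//; last by apply: integral_ge0.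
by apply: eq_integral => x _; rewrite /fubini_F/= ge0_integralZr.
Qed.

Lemma leb3E (F : mspace3 R -> \bar R) : measurable_fun setT F ->
  (forall x, 0 <= F x) ->
  \int[leb3]_x F x = \int[leb]_z \int[leb2]_p F (p, z).
Proof. exact: (@fubini_tonelli2 _ _ _ _ R leb2 leb F). Qed.

Lemma leb3E_line (F : mspace3 R -> \bar R) : measurable_fun setT F ->
  (forall x, 0 <= F x) ->
  \int[leb3]_x F x = \int[leb2]_p \int[leb]_z F (p, z).
Proof. exact: (@fubini_tonelli1 _ _ _ _ R leb2 leb F). Qed.

Lemma lee_sqr_add (A B : \bar R) : 0 <= A -> 0 <= B ->
  2%:E * (A * B) <= A * A + B * B.
Proof.
case: A => [a| |]//; case: B => [b| |]//; rewrite ?lee_fin => a0 b0.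
- by have := sqr_ge0 (a - b)%R; nra.
- by rewrite mulyy addey ?leey// -EFinM.
- by rewrite mulyy addye ?leey// -EFinM.
- by rewrite !mulyy addye ?leey.
Qed.

(* A plane [z = cst] carries two bounds of the square of [phi], one by a function
   of y alone and one by a function of x alone; the integral of that square over
   the plane is bounded by the one of [2 * |phi * d3|] over the space. *)
Lemma ladyzhenskaya_ereal (phi d1 d2 d3 : space3 R -> R) (M : R) :
  continuous phi -> continuous d1 -> continuous d2 -> continuous d3 ->
  (forall y z t : R, is_derive t (1%R : R) (fun t => phi (t, y, z)) (d1 (t, y, z))) ->
  (forall x z t : R, is_derive t (1%R : R) (fun t => phi (x, t, z)) (d2 (x, t, z))) ->
  (forall x y t : R, is_derive t (1%R : R) (fun t => phi (x, y, t)) (d3 (x, y, t))) ->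
  (forall x y z : R, (x <= M \/ y <= M \/ z <= M)%R -> phi (x, y, z) = 0%R) ->
  2%:E * \int[leb3]_x (phi x ^+ 4)%:E <=
  4%:E * (\int[leb3]_x (phi x ^+ 2)%:E + \int[leb3]_x (d3 x ^+ 2)%:E) *
  (\int[leb3]_x (d1 x ^+ 2)%:E + \int[leb3]_x (d2 x ^+ 2)%:E).
Proof.
move=> cphi cd1 cd2 cd3 D1 D2 D3 phi0.
have mphi := continuous_measurable3 cphi.
have md1 := continuous_measurable3 cd1.
have md2 := continuous_measurable3 cd2.
have md3 := continuous_measurable3 cd3.
have sq_meas (f : mspace3 R -> R) : measurable_fun setT f ->
    measurable_fun setT (fun x => (f x ^+ 2)%:E).
  by move=> mf; apply/measurable_EFinP; exact: measurable_funX.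
pose h (d : mspace3 R -> R) (p : mspace3 R) : \bar R := (`|2 * (phi p * d p)|)%:E.
have mh d : measurable_fun setT d -> measurable_fun setT (h d).
  move=> md; apply/measurable_EFinP; apply: measurableT_comp => //.
  by apply: measurable_funM => //; exact: measurable_funM.
have h0 d p : 0 <= h d p by rewrite lee_fin.
have line1 x y z : (phi (x, y, z) ^+ 2)%:E <= \int[leb]_t h d1 (t, y, z).
  (* [Num.min M x - 1] lies below both [M] and [x], so [phi] vanishes there and the line integral
     may start from it. *)
  have lt : (Num.min M x - 1 < x)%R.
    by rewrite (@lt_le_trans _ _ (Num.min M x))// ?ltrBlDr ?ltrDl// ge_min lexx orbT.
  apply: (@sqr_le_integral R (fun t => phi (t, y, z)) (fun t => d1 (t, y, z)) _ _ lt) => //.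
    apply: phi0; left; rewrite (@le_trans _ _ (Num.min M x))// ?gerBl// ?ge_min ?lexx//.
  move=> t; apply: (@continuous_comp _ _ _ (fun t : R => (t, y, z)) d1); last exact: cd1.
  by move: t; do ![apply: continuous_pair]; move=> ?; (exact: cvg_id || exact: cvg_cst).
have line2 x y z : (phi (x, y, z) ^+ 2)%:E <= \int[leb]_t h d2 (x, t, z).
  have lt : (Num.min M y - 1 < y)%R.
    by rewrite (@lt_le_trans _ _ (Num.min M y))// ?ltrBlDr ?ltrDl// ge_min lexx orbT.
  apply: (@sqr_le_integral R (fun t => phi (x, t, z)) (fun t => d2 (x, t, z)) _ _ lt) => //.
    apply: phi0; right; left; rewrite (@le_trans _ _ (Num.min M y))// ?gerBl// ?ge_min ?lexx//.
  move=> t; apply: (@continuous_comp _ _ _ (fun t : R => (x, t, z)) d2); last exact: cd2.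
  by move: t; do ![apply: continuous_pair]; move=> ?; (exact: cvg_id || exact: cvg_cst).
have line3 x y z : (phi (x, y, z) ^+ 2)%:E <= \int[leb]_t h d3 (x, y, t).
  have lt : (Num.min M z - 1 < z)%R.
    by rewrite (@lt_le_trans _ _ (Num.min M z))// ?ltrBlDr ?ltrDl// ge_min lexx orbT.
  apply: (@sqr_le_integral R (fun t => phi (x, y, t)) (fun t => d3 (x, y, t)) _ _ lt) => //.
    apply: phi0; right; right; rewrite (@le_trans _ _ (Num.min M z))// ?gerBl// ?ge_min ?lexx//.
  move=> t; apply: (@continuous_comp _ _ _ (fun t : R => (x, y, t)) d3); last exact: cd3.
  by move: t; do ![apply: continuous_pair]; move=> ?; (exact: cvg_id || exact: cvg_cst).
pose S := \int[leb3]_x h d3 x.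
have S0 : 0 <= S by apply: integral_ge0.
pose P (z : measurableTypeR R) := \int[leb2]_p (phi (p, z) ^+ 2)%:E.
have slice (f : mspace3 R -> R) z : measurable_fun setT f ->
  measurable_fun setT (fun p : measurableTypeR R * measurableTypeR R => f (p, z)).
  by move=> mf; exact: (measurableT_comp mf (pair2_measurable z)).
have eslice (f : mspace3 R -> \bar R) z : measurable_fun setT f ->
  measurable_fun setT (fun p : measurableTypeR R * measurableTypeR R => f (p, z)).
  by move=> mf; exact: (measurableT_comp mf (pair2_measurable z)).
have PS z : P z <= S.
  rewrite /S leb3E_line; [|exact: mh|exact: h0].
  apply: ge0_le_integral => //.
  - by move=> p _; rewrite lee_fin sqr_ge0.
  - by apply: (eslice (fun q => (phi q ^+ 2)%:E)); exact: sq_meas.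
  - by apply: measurable_fun_fubini_tonelli_F => //; exact: mh.
  - by move=> [x y] _; exact: line3.
pose G (d : mspace3 R -> R) (z : measurableTypeR R) := \int[leb2]_p (d (p, z) ^+ 2)%:E.
have mG d : measurable_fun setT d -> measurable_fun setT (G d).
  move=> md; apply: (measurable_fun_fubini_tonelli_G (fun p => (d p ^+ 2)%:E)).
    exact: sq_meas.
  by move=> p; rewrite lee_fin sqr_ge0.
have G0 d z : 0 <= G d z by apply: integral_ge0 => p _; rewrite lee_fin sqr_ge0.
pose A (d : mspace3 R -> R) (z : measurableTypeR R) := \int[leb2]_p h d (p, z).
have A0 d z : 0 <= A d z by apply: integral_ge0.
(* Cauchy-Schwarz with 2 phi as one factor gives 4 P(z) G(z), and P(z) <= S uniformly in z: only G
   remains to be integrated in z. *)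
have AA d z : measurable_fun setT d -> A d z * A d z <= 4%:E * S * G d z.
  move=> md.
  have m2 : measurable_fun setT (fun p : measurableTypeR R * measurableTypeR R => 2 * phi (p, z))%R.
    by apply: measurable_funM => //; exact: slice.
  have := ge0_ereal_cauchy_schwarz leb2 m2 (slice _ z md).
  rewrite (_ : \int[leb2]_x (`|2 * phi (x, z) * d (x, z)|%R)%:E = A d z); last first.
    by apply: eq_integral => p _; rewrite /h mulrA.
  move=> /le_trans; apply; rewrite lee_wpmul2r//; first exact: G0.
  rewrite (_ : \int[leb2]_x ((2 * phi (x, z)) ^+ 2)%:E = 4%:E * P z).
    by rewrite lee_wpmul2l.
  rewrite /P -ge0_integralZl_EFin//; first 1 last.
  - by move=> p _; rewrite lee_fin sqr_ge0.
  - by apply: (eslice (fun p => (phi p ^+ 2)%:E)); exact: sq_meas.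
  apply: eq_integral => p _; rewrite -EFinM; congr EFin; ring.
(* One factor phi^2 is bounded by a function of y, the other by a function of x; Tonelli's theorem
   then separates the two integrals. *)
have slab z : \int[leb2]_p (phi (p, z) ^+ 4)%:E <= A d1 z * A d2 z.
  pose F1 (y : measurableTypeR R) := \int[leb]_t h d1 (t, y, z).
  pose F2 (x : measurableTypeR R) := \int[leb]_t h d2 (x, t, z).
  have mF1 : measurable_fun setT F1.
    apply: (measurable_fun_fubini_tonelli_G (fun p => h d1 (p, z))) => //.
    exact: (eslice (h d1) z (mh _ md1)).
  have mF2 : measurable_fun setT F2.
    apply: (measurable_fun_fubini_tonelli_F (fun p => h d2 (p, z))) => //.
    exact: (eslice (h d2) z (mh _ md2)).
  have F10 y : 0 <= F1 y by apply: integral_ge0.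
  have F20 x : 0 <= F2 x by apply: integral_ge0.
  have -> : A d1 z = \int[leb]_y F1 y.
    by rewrite /A /leb2 fubini_tonelli2//; exact: (eslice (h d1) z (mh _ md1)).
  have -> : A d2 z = \int[leb]_x F2 x.
    by rewrite /A /leb2 fubini_tonelli1//; exact: (eslice (h d2) z (mh _ md2)).
  rewrite -integral_prod_mul//; apply: ge0_le_integral => //.
  - by move=> p _; rewrite lee_fin exprn_even_ge0.
  - apply/measurable_EFinP; apply: measurable_funX.
    exact: slice.
  - by apply: emeasurable_funM; apply: measurableT_comp.
  - move=> [x y] _ /=; rewrite (_ : 4 = 2 + 2)%N// exprD EFinM.
    by apply: lee_pmul; rewrite ?lee_fin ?sqr_ge0//.
have m4 : measurable_fun setT (fun x : mspace3 R => (phi x ^+ 4)%:E).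
  by apply/measurable_EFinP; exact: measurable_funX.
(* Here A1 A2 is split by 2 A1 A2 <= A1^2 + A2^2; keeping the 2 on the left avoids a division in the
   extended reals. *)
have key : 2%:E * \int[leb3]_x (phi x ^+ 4)%:E <=
   4%:E * S * (\int[leb3]_x (d1 x ^+ 2)%:E + \int[leb3]_x (d2 x ^+ 2)%:E).
  have p40 x : 0 <= (phi x ^+ 4)%:E by rewrite lee_fin exprn_even_ge0.
  have q0 (d : mspace3 R -> R) x : 0 <= (d x ^+ 2)%:E by rewrite lee_fin sqr_ge0.
  rewrite !leb3E//; try exact: sq_meas.
  rewrite -ge0_integralD//; try exact: mG; try by move=> z _; exact: G0.
  have mI4 : measurable_fun setT
      (fun z : measurableTypeR R => \int[leb2]_p (phi (p, z) ^+ 4)%:E).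
    exact: (@measurable_fun_fubini_tonelli_G _ _ _ _ _ leb2 _ m4 p40).
  have mGD : measurable_fun setT (fun z => G d1 z + G d2 z).
    by apply: emeasurable_funD; exact: mG.
  have k0 : 0 <= 4%:E * S by rewrite mule_ge0.
  rewrite -ge0_integralZl_EFin//; last by move=> z _; apply: integral_ge0.
  rewrite -ge0_integralZl//; last by move=> z _; rewrite adde_ge0//; exact: G0.
  apply: ge0_le_integral.
  - by [].
  - by move=> z _; rewrite mule_ge0//; apply: integral_ge0.
  - by apply: measurable_funeM; exact: mI4.
  - by apply: measurable_funeM; exact: mGD.
  - move=> z _.
    apply: (@le_trans _ _ (2%:E * (A d1 z * A d2 z))).
      by rewrite lee_wpmul2l.
    apply: le_trans (lee_sqr_add (A0 _ _) (A0 _ _)) _.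
    rewrite (ge0_muleDr _ (G0 d1 z) (G0 d2 z)).
    by apply: leeD; exact: AA.
(* It remains to bound [S], by 2 |phi d3| <= phi^2 + d3^2. *)
apply: le_trans key _; rewrite lee_wpmul2r//.
  by rewrite adde_ge0//; apply: integral_ge0 => x _; rewrite lee_fin sqr_ge0.
rewrite lee_wpmul2l// -ge0_integralD//; first 1 last.
- by move=> x _; rewrite lee_fin sqr_ge0.
- exact: sq_meas.
- by move=> x _; rewrite lee_fin sqr_ge0.
- exact: sq_meas.
apply: ge0_le_integral => //.
- exact: mh.
- by apply: emeasurable_funD; exact: sq_meas.
- move=> x _; rewrite /h -EFinD lee_fin ler_norml.
  have := sqr_ge0 (phi x - d3 x); have := sqr_ge0 (phi x + d3 x).
  by move=> ? ?; apply/andP; split; nra.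
Qed.

End ladyzhenskaya.

(** * Test functions *)

Section smooth.
Variable R : realType.
Implicit Types f g : sfield R.

(** The class C^n. The product rule turns an iterated derivative into a sum of products, which the
    lists of [smooth3] handle badly; an induction on the number of derivatives, for all functions at
    once, absorbs it. *)
Fixpoint diffn (n : nat) f : Prop :=
  if n is n'.+1 then
    [/\ continuous f, forall i x, derivable f x (e3 i)
      & forall i, diffn n' (pderiv i f)]
  else continuous f.

Lemma diffnW n f : diffn n.+1 f -> diffn n f.
Proof.
elim: n f => [|n ih] f; first by case.
by move=> [cf df pf]; split=> // i; apply: ih; exact: pf.
Qed.

(** [foldr] differentiates along the last entry of the list first, hence the induction from the
    right end. *)
Lemma smooth3P f : smooth3 f <-> forall n, diffn n f.
Proof.
split=> [sf n|df s].
  elim: n f sf => [|n ih] f sf; first by have [] := sf [::].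
  split; [by have [] := sf [::]|by have [] := sf [::]|].
  move=> i; apply: ih => s.
  by have := sf (rcons s i); rewrite foldr_rcons.
elim/last_ind: s f df => [|s i ih] f df.
  by have [cf dif _] := df 1%N; split.
by rewrite foldr_rcons; apply: ih => n; have [_ _] := df n.+1; apply.
Qed.

Lemma diffnB n f g : diffn n f -> diffn n g -> diffn n (f - g).
Proof.
elim: n f g => [|n ih] f g; first by move=> cf cg x; exact: (continuousB (cf x) (cg x)).
move=> [cf df pf] [cg dg pg]; split.
- by move=> x; exact: (continuousB (cf x) (cg x)).
- by move=> i x; exact: (derivableB (df i x) (dg i x)).
- move=> i; have -> : pderiv i (f - g) = pderiv i f - pderiv i g.
    by apply/funext => x; rewrite /pderiv deriveB.
  by apply: ih; [exact: pf|exact: pg].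
Qed.

Lemma diffnD n f g : diffn n f -> diffn n g -> diffn n (f + g).
Proof.
elim: n f g => [|n ih] f g; first by move=> cf cg x; exact: (continuousD (cf x) (cg x)).
move=> [cf df pf] [cg dg pg]; split.
- by move=> x; exact: (continuousD (cf x) (cg x)).
- by move=> i x; exact: (derivableD (df i x) (dg i x)).
- move=> i; have -> : pderiv i (f + g) = pderiv i f + pderiv i g.
    by apply/funext => x; rewrite /pderiv deriveD.
  by apply: ih; [exact: pf|exact: pg].
Qed.

Lemma pderivM i f g : (forall x, derivable f x (e3 i)) ->
  (forall x, derivable g x (e3 i)) ->
  pderiv i (f * g) = f * pderiv i g + g * pderiv i f.
Proof. by move=> df dg; apply/funext => x; rewrite /pderiv deriveM. Qed.

(** The product rule leaves one factor undifferentiated; [diffnW] lowers its order to that of the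
    differentiated one. *)
Lemma diffnM n f g : diffn n f -> diffn n g -> diffn n (f * g).
Proof.
elim: n f g => [|n ih] f g; first by move=> cf cg x; exact: (continuousM (cf x) (cg x)).
move=> hf hg; have [cf df pf] := hf; have [cg dg pg] := hg; split.
- by move=> x; exact: (continuousM (cf x) (cg x)).
- by move=> i x; exact: (derivableM (df i x) (dg i x)).
- move=> i; rewrite pderivM; [|exact: df|exact: dg].
  by apply: diffnD; [exact: ih (diffnW hf) (pg i)|exact: ih (diffnW hg) (pf i)].
Qed.

Lemma smooth3B f g : smooth3 f -> smooth3 g -> smooth3 (f - g).
Proof. by move=> /smooth3P hf /smooth3P hg; apply/smooth3P => n; exact: diffnB. Qed.

Lemma smooth3M f g : smooth3 f -> smooth3 g -> smooth3 (f * g).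
Proof. by move=> /smooth3P hf /smooth3P hg; apply/smooth3P => n; exact: diffnM. Qed.

Lemma smooth3_pderiv i f : smooth3 f -> smooth3 (pderiv i f).
Proof. by move=> /smooth3P hf; apply/smooth3P => n; have [_ _] := hf n.+1; apply. Qed.

Lemma smooth3_continuous f : smooth3 f -> continuous f.
Proof. by move=> /(_ [::]) []. Qed.

Lemma smooth3_derivable f i x : smooth3 f -> derivable f x (e3 i).
Proof. by move=> /(_ [::]) [_]; apply. Qed.

End smooth.

(** * Closure and boundedness properties of test functions *)

Section test_functions.
Variables (R : realType) (Omega : set (space3 R)).
Implicit Types phi psi : sfield R.

(** Spares computing the support of a difference, a product or a derivative: a compact set around it
    inside [Omega] is enough. *)
Lemma test_function_supp phi (K : set (space3 R)) : smooth3 phi ->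
  compact K -> closed K -> K `<=` Omega -> [set x | phi x != 0] `<=` K ->
  test_function Omega phi.
Proof.
move=> sphi cK clK KO phiK.
have cl : closure [set x | phi x != 0] `<=` K.
  by rewrite [X in _ `<=` X](closure_id K).1//; exact: closure_subset.
split=> //; last exact: subset_trans KO.
exact: subclosed_compact (@closed_closure _ _) cK cl.
Qed.

Lemma test_functionB phi psi : test_function Omega phi ->
  test_function Omega psi -> test_function Omega (phi - psi).
Proof.
move=> [s1 c1 k1] [s2 c2 k2].
apply: (@test_function_supp _ (closure [set x | phi x != 0] `|`
                               closure [set x | psi x != 0])).
- exact: smooth3B.
- exact: compactU.
- by apply: closedU; exact: closed_closure.
- by rewrite subUset.
- move=> x /= h; have [p0|p0] := eqVneq (phi x) 0.
    right; apply: subset_closure => /=; apply: contraNneq h => q0.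
    by apply/eqP; rewrite -[LHS]/(phi x - psi x) p0 q0 subr0.
  by left; apply: subset_closure.
Qed.

Lemma test_functionM phi psi : test_function Omega phi ->
  test_function Omega psi -> test_function Omega (phi * psi).
Proof.
move=> [s1 c1 k1] [s2 c2 k2].
apply: (@test_function_supp _ (closure [set x | phi x != 0])) => //.
- exact: smooth3M.
- exact: closed_closure.
- move=> x /= h; apply: subset_closure => /=; apply: contraNneq h => q0.
  by apply/eqP; rewrite -[LHS]/(phi x * psi x) q0 mul0r.
Qed.

Lemma test_function_pderiv i phi : test_function Omega phi ->
  test_function Omega (pderiv i phi).
Proof.
move=> [s1 c1 k1].
apply: (@test_function_supp _ (closure [set x | phi x != 0])) => //.
- exact: smooth3_pderiv.
- exact: closed_closure.
- move=> x /= h; apply: contrapT => nx; move/negP: h; apply; apply/eqP.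
  (* Off the closed support, [phi] vanishes on a whole neighbourhood, and so does its derivative at
     the point. *)
  have : open (~` closure [set x | phi x != 0]).
    by rewrite openC; exact: closed_closure.
  move=> /(_ x)/(_ nx) /= nb.
  rewrite /pderiv (@near_eq_derive _ _ _ _ (cst 0))//; last first.
    apply: filterS nb => y /= ny; apply/eqP; apply: contrapT => /negP py.
    by apply: ny; exact: subset_closure.
  by rewrite derive_cst.
Qed.

Lemma test_function_out phi x : test_function Omega phi -> ~ Omega x -> phi x = 0.
Proof.
move=> [_ _ k1] nx; apply/eqP; apply: contrapT => /negP px.
by apply: nx; apply: k1; exact: subset_closure.
Qed.

Lemma test_function_bounded phi : test_function Omega phi ->
  exists M, forall x, `|phi x| <= M.
Proof.
move=> [s1 c1 k1].
have := continuous_compact (continuous_subspaceT (smooth3_continuous s1)) c1.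
move=> /compact_bounded[M [_ hM]]; exists (Num.max (M + 1) 0) => x.
have [->|p0] := eqVneq (phi x) 0; first by rewrite normr0 le_max lexx orbT.
rewrite le_max; apply/orP; left; apply: (hM (M + 1)); first by rewrite ltrDl.
by exists x => //; exact: subset_closure.
Qed.

Lemma test_function_bounded_supp phi : test_function Omega phi ->
  exists M, forall x y z, (x <= M \/ y <= M \/ z <= M)%R -> phi (x, y, z) = 0.
Proof.
move=> [s1 c1 k1]; have [M [_ hM]] := compact_bounded c1.
(* Points of the support have coordinates at least [- (M + 1)], strictly above this value. *)
exists (- M - 2) => x y z h; apply/eqP; apply: contrapT => /negP p0.
have M1 : M < M + 1 by rewrite ltrDl.
have cp : closure [set x | phi x != 0] (x, y, z) by exact: subset_closure.
have := hM _ M1 _ cp.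
rewrite /= !prod_normE /= !ge_max => /andP[/andP[]].
rewrite !ler_norml => /andP[hx _] /andP[hy _] /andP[hz _].
by case: h => [h|[h|h]]; lra.
Qed.

End test_functions.

(** Both sides have the same difference quotient, so a directional derivative is enough and no
    differential has to exist. *)
Lemma is_derive_line (R : realType) (V : normedModType R) (f : V -> R)
    (c : R -> V) (v : V) (t : R) :
  (forall h, c (h + t) = h *: v + c t) -> derivable f (c t) v ->
  is_derive t (1 : R) (fun s => f (c s)) ('D_v f (c t)).
Proof.
move=> hc df.
have E : (fun h => h^-1 *: (((fun s => f (c s)) \o shift t) (h *: (1 : R)) - f (c t)))
  = (fun h => h^-1 *: ((f \o shift (c t)) (h *: v) - f (c t))).
  by apply/funext => h /=; rewrite [h *: 1]mulr1 hc.
by split; rewrite /derivable /derive /= E.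
Qed.

Lemma sum_ord3 (V : nmodType) (F : 'I_3 -> V) :
  \sum_(i < 3) F i = F ord0 + (F (Ordinal (isT : (1 < 3)%N))
                               + F (Ordinal (isT : (2 < 3)%N))).
Proof.
rewrite !big_ord_recl big_ord0 addr0.
by congr (_ + (F _ + F _)); exact/val_inj.
Qed.

(** Each factor on the right is at most the full energy N + A + B + C; halving the 4 leaves the
    2. *)
Lemma energy_bound (R : realType) (X N A B C : R) :
  0 <= N -> 0 <= A -> 0 <= B -> 0 <= C ->
  (2%:E * X%:E <= 4%:E * (N%:E + C%:E) * (A%:E + B%:E))%E ->
  X <= 2 * (N + (A + (B + C))) ^+ 2.
Proof.
move=> N0 A0 B0 C0; rewrite -!EFinD -!EFinM lee_fin => h.
have : (N + C) * (A + B) <= (N + (A + (B + C))) ^+ 2.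
  by rewrite expr2; apply: ler_pM; lra.
by move: h; rewrite -mulrA; lra.
Qed.

(** * L^4 bound of a test function by its H^1 norm *)

Section test_function_L4.
Variables (R : realType) (Omega : set (space3 R)).
Hypotheses (oO : open Omega) (bO : bounded_set Omega).
Implicit Types phi psi : sfield R.
Local Notation sqi := (sq_integrable (@leb3 R) Omega).
Local Notation nrm3 := (nrm (@leb3 R) Omega).

Lemma measurable_domain : measurable (Omega : set (mspace3 R)).
Proof. exact: open_measurable3. Qed.

Lemma leb3_domain_lty : (leb3 (Omega : set (mspace3 R)) < +oo)%E.
Proof.
case: bO => M [_ hM].
pose I : set (measurableTypeR R) := `[- (M + 1), M + 1]%classic.
have mI : measurable I by exact: measurable_itv.
have fI : (@lebesgue_measure R I < +oo)%E.
  by rewrite lebesgue_measure_itv /=; case: ifP => _; rewrite -?EFinB ltry.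
have fI' : @lebesgue_measure R I \is a fin_num by rewrite ge0_fin_numE.
have mII : measurable (I `*` I) by exact: measurableX.
apply: (@le_lt_trans _ _ (leb3 ((I `*` I) `*` I : set (mspace3 R)))).
  apply: le_measure; rewrite ?inE; [exact: measurable_domain|exact: measurableX|].
  move=> [[x y] z] Ox; have M1 : M < M + 1 by rewrite ltrDl.
  have /= := hM _ M1 _ Ox; rewrite !prod_normE /= !ge_max => /andP[/andP[hx hy] hz].
  by split; [split|]; rewrite /I /= in_itv /= -ler_norml.
have -> : leb3 ((I `*` I) `*` I : set (mspace3 R)) =
    (@leb2 R (I `*` I) * @lebesgue_measure R I)%E.
  exact: (@product_measure1E _ _ _ _ R leb2 lebesgue_measure).
rewrite /leb2 product_measure1E//; apply: lte_mul_pinfty => //.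
  by rewrite mule_ge0.
by rewrite fin_numM.
Qed.

Lemma measurable_test_function phi : test_function Omega phi ->
  measurable_fun setT (phi : mspace3 R -> R).
Proof. by move=> [s _ _]; apply: continuous_measurable3; exact: smooth3_continuous. Qed.

Lemma test_function_sq_integrable phi : test_function Omega phi -> sqi phi.
Proof.
move=> tphi; have mphi := measurable_test_function tphi.
have mO := measurable_domain; have [M hM] := test_function_bounded tphi.
split; first exact: measurable_funTS.
apply: measurable_bounded_integrable => //; first exact: leb3_domain_lty.
  by apply: measurable_funTS; exact: measurable_funM.
exists (M * M); split; first exact: num_real.
move=> N MN x _ /=; apply: le_trans (ltW MN); rewrite normrM.
by apply: ler_pM.
Qed.

(** Slicing takes place in the whole space, norms live on [Omega]. The exponent is a successor so
    that the integrand vanishes outside. *)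
Lemma integral_test phi (n : nat) : test_function Omega phi ->
  (\int[leb3]_x (phi x ^+ n.+1)%:E = \int[leb3]_(x in Omega) (phi x ^+ n.+1)%:E)%E.
Proof.
move=> tphi; rewrite [RHS]integral_mkcond; apply: eq_integral => x _.
rewrite patchE; case: ifPn => // /negP nx.
rewrite (test_function_out tphi) ?expr0n//.
by move=> Ox; apply: nx; rewrite inE.
Qed.

Lemma dot_test phi : test_function Omega phi ->
  (\int[leb3]_x (phi x ^+ 2)%:E = (nrm3 phi ^+ 2)%:E)%E.
Proof.
move=> tphi; rewrite integral_test// sqr_nrm.
rewrite /dot /Rintegral fineK; last first.
  exact: (integrable_fin_num measurable_domain (test_function_sq_integrable tphi).2).
by apply: eq_integral => x _; rewrite expr2.
Qed.

(* Squared norm of H^1. *)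
Definition test_energy phi : R :=
  nrm3 phi ^+ 2 + \sum_(i < 3) nrm3 (pderiv i phi) ^+ 2.

Lemma ladyzhenskaya phi : test_function Omega phi ->
  quartic leb3 Omega phi /\ nrm3 (phi \* phi) ^+ 2 <= 2 * test_energy phi ^+ 2.
Proof.
move=> tphi; have mphi := measurable_test_function tphi.
have mO := measurable_domain.
have tM := test_functionM tphi tphi.
have sff : sqi (phi \* phi) := test_function_sq_integrable tM.
split; first by split; [exact: measurable_funTS|].
have td i := test_function_pderiv i tphi.
have sphi : smooth3 phi by case: tphi.
have cd i : continuous (pderiv i phi).
  by apply: smooth3_continuous; exact: smooth3_pderiv.
pose i1 : 'I_3 := Ordinal (isT : (1 < 3)%N).
pose i2 : 'I_3 := Ordinal (isT : (2 < 3)%N).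
have [M hM] := test_function_bounded_supp tphi.
have := @ladyzhenskaya_ereal R phi (pderiv ord0 phi) (pderiv i1 phi) (pderiv i2 phi)
  M (smooth3_continuous sphi) (cd _) (cd _) (cd _).
have dl i (c : R -> space3 R) t : (forall h, c (h + t) = h *: e3 i + c t) ->
    is_derive t (1 : R) (fun s => phi (c s)) (pderiv i phi (c t)).
  by move=> hc; apply: is_derive_line => //; exact: smooth3_derivable.
have a1 (h r : R) : h *: (1 : R) + r = h + r by rewrite [h *: 1]mulr1.
have a0 (h r : R) : h *: (0 : R) + r = r by rewrite scaler0 add0r.
have D0 (y z t : R) : is_derive t (1 : R) (fun t => phi (t, y, z))
    (pderiv ord0 phi (t, y, z)).
  apply: (dl ord0 (fun t => (t, y, z))) => h.
  transitivity (h *: (1 : R) + t, h *: (0 : R) + y, h *: (0 : R) + z); last by [].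
  by rewrite a1 !a0.
have D1 (x z t : R) : is_derive t (1 : R) (fun t => phi (x, t, z))
    (pderiv i1 phi (x, t, z)).
  apply: (dl i1 (fun t => (x, t, z))) => h.
  transitivity (h *: (0 : R) + x, h *: (1 : R) + t, h *: (0 : R) + z); last by [].
  by rewrite a1 !a0.
have D2 (x y t : R) : is_derive t (1 : R) (fun t => phi (x, y, t))
    (pderiv i2 phi (x, y, t)).
  apply: (dl i2 (fun t => (x, y, t))) => h.
  transitivity (h *: (0 : R) + x, h *: (0 : R) + y, h *: (1 : R) + t); last by [].
  by rewrite a1 !a0.
move=> /(_ D0 D1 D2 hM).
rewrite [X in (_ <= _ * (X + _) * _)%E](dot_test tphi).
rewrite [X in (_ <= _ * (_ + X) * _)%E](dot_test (td i2)).
rewrite [X in (_ <= _ * (X + _))%E](dot_test (td ord0)).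
rewrite [X in (_ <= _ * (_ + X))%E](dot_test (td i1)).
have H4 : (\int[leb3]_x (phi x ^+ 4)%:E)%E = (nrm3 (phi \* phi) ^+ 2)%:E.
  rewrite (integral_test 3 tphi) sqr_nrm /dot /Rintegral fineK; last first.
    exact: (integrable_fin_num mO sff.2).
  by apply: eq_integral => x _; congr EFin => /=; ring.
rewrite [X in (_ * X <= _)%E]H4 => H.
rewrite /test_energy (sum_ord3 (fun i => nrm3 (pderiv i phi) ^+ 2)).
exact: (energy_bound (sqr_ge0 _) (sqr_ge0 _) (sqr_ge0 _) (sqr_ge0 _) H).
Qed.

End test_function_L4.

(** * The convection form on H^1_0 *)

Section sobolev.
Variables (R : realType) (Omega : set (space3 R)).
Hypotheses (oO : open Omega) (bO : bounded_set Omega).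
Let mO := measurable_domain oO.
Local Notation sqi := (sq_integrable (@leb3 R) Omega).
Local Notation nrm3 := (nrm (@leb3 R) Omega).
Local Notation dot3 := (dot (@leb3 R) Omega).
Local Notation quartic3 := (quartic (@leb3 R) Omega).

Lemma L2_sq_integrable (f : sfield R) : L2 Omega f -> sqi f.
Proof.
rewrite /L2 /= => hf; have := Lfun2_integrable_sqr hf.
move: hf => /[!inE] /andP[/[!inE]/= mf _] hi.
split.
  have /(measurable_restrict f mO measurableT) := mf.
  by rewrite setTI.
apply/(integrable_mkcond _ mO); move: hi; apply: eq_integrable => // x _ /=.
by rewrite !patchE; case: ifP => _ //=; rewrite expr0n.
Qed.

(** Membership in H^1 rules out the default value 0 of [xget]. *)
Lemma is_wderiv_wderiv (u : sfield R) i : H1 Omega u ->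
  is_wderiv Omega i u (wderiv Omega i u).
Proof. by move=> [_ /(_ i) [g hg]]; apply: xgetPex; exists g. Qed.

Lemma H10_sq_integrable (u : sfield R) : H10 Omega u -> sqi u.
Proof. by move=> [[/L2_sq_integrable]]. Qed.

Lemma wderiv_sq_integrable (u : sfield R) i : H10 Omega u ->
  sqi (wderiv Omega i u).
Proof. by move=> [/(is_wderiv_wderiv i) [/L2_sq_integrable]]. Qed.

(** Ladyzhenskaya's inequality is known for test functions only, so it is applied to
    [phi m \- phi l]; letting l tend to infinity with [quartic_lim] bounds [phi m \- u] in L^4 by
    the H^1 distance [b m]. *)
Lemma H10_cvg_quartic (u : sfield R) (phi : nat -> sfield R) : H10 Omega u ->
  (forall m, test_function Omega (phi m)) ->
  L2norm Omega (u - phi m) @[m --> \oo] --> (0 : R) ->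
  (forall i, L2norm Omega (wderiv Omega i u - pderiv i (phi m)) @[m --> \oo]
     --> (0 : R)) ->
  quartic3 u /\
  nrm3 ((phi m \- u) \* (phi m \- u)) @[m --> \oo] --> (0 : R).
Proof.
move=> hu tphi cu cdu.
have su := H10_sq_integrable hu; have sdu i := wderiv_sq_integrable i hu.
have sphi m : sqi (phi m) by exact: (test_function_sq_integrable oO bO (tphi m)).
have sdphi m i : sqi (pderiv i (phi m)).
  exact: (test_function_sq_integrable oO bO (test_function_pderiv i (tphi m))).
pose b m := nrm3 (u \- phi m) +
            \sum_(i < 3) nrm3 (wderiv Omega i u \- pderiv i (phi m)).
have cb : b m @[m --> \oo] --> (0 : R).
  have -> : b = (fun m => nrm3 (u \- phi m) +
      (nrm3 (wderiv Omega ord0 u \- pderiv ord0 (phi m)) +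
      (nrm3 (wderiv Omega (Ordinal (isT : (1 < 3)%N)) u
             \- pderiv (Ordinal (isT : (1 < 3)%N)) (phi m)) +
       nrm3 (wderiv Omega (Ordinal (isT : (2 < 3)%N)) u
             \- pderiv (Ordinal (isT : (2 < 3)%N)) (phi m))))).
    by apply/funext => m; rewrite /b sum_ord3.
  have -> : 0 = 0 + (0 + (0 + 0)) :> R by rewrite !addr0.
  apply: cvgD; first exact: cu.
  by apply: cvgD; [|apply: cvgD]; exact: cdu.
have b0 m : 0 <= b m.
  by rewrite addr_ge0 ?nrm_ge0// sumr_ge0// => i _; exact: nrm_ge0.
have sumsq (F : 'I_3 -> R) : (forall i, 0 <= F i) ->
    \sum_(i < 3) F i ^+ 2 <= (\sum_(i < 3) F i) ^+ 2.
  move=> F0; rewrite !sum_ord3.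
  have := F0 ord0; have := F0 (Ordinal (isT : (1 < 3)%N)).
  have := F0 (Ordinal (isT : (2 < 3)%N)); nra.
have tri f g h : sqi f -> sqi g -> sqi h ->
    nrm3 (f \- g) <= nrm3 (h \- f) + nrm3 (h \- g).
  move=> sf sg sh; have -> : f \- g = (h \- g) \- (h \- f).
    by apply/funext => x /=; ring.
  by rewrite addrC; apply: nrmB => //; exact: sq_integrableB.
have energy m l : test_energy Omega (phi m \- phi l) <= (b m + b l) ^+ 2.
  pose F i := nrm3 (wderiv Omega i u \- pderiv i (phi m)) +
              nrm3 (wderiv Omega i u \- pderiv i (phi l)).
  pose a := nrm3 (u \- phi m) + nrm3 (u \- phi l).
  have -> : b m + b l = a + \sum_(i < 3) F i.
    by rewrite [LHS]addrACA; congr (_ + _); apply/esym; exact: big_split.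
  have F0 i : 0 <= F i by rewrite addr_ge0// nrm_ge0.
  have a0 : 0 <= a by rewrite addr_ge0// nrm_ge0.
  have S0 : 0 <= \sum_(i < 3) F i by exact: sumr_ge0.
  apply: (@le_trans _ _ (a ^+ 2 + \sum_(i < 3) F i ^+ 2)).
    rewrite lerD//.
      by rewrite ler_sqr ?nnegrE ?nrm_ge0//; exact: tri.
    apply: ler_sum => i _; rewrite ler_sqr ?nnegrE ?nrm_ge0//.
    have [s1 _ _] := tphi m; have [s2 _ _] := tphi l.
    have -> : pderiv i (phi m \- phi l) = pderiv i (phi m) \- pderiv i (phi l).
      by apply/funext => x; apply: deriveB; exact: smooth3_derivable.
    exact: tri.
  have := sumsq F F0; nra.
(* [quartic_lim] wants a constant independent of l: [eta] stands for [b l], which is eventually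
   smaller. *)
have bnd m eta : 0 < eta -> quartic3 (phi m \- u) /\
    nrm3 ((phi m \- u) \* (phi m \- u)) ^+ 2 <= 2 * ((b m + eta) ^+ 2) ^+ 2.
  move=> eta0.
  apply: (@quartic_lim _ _ _ _ _ mO (fun l => phi m \- phi l)).
  - by move=> l; exact: sq_integrableB.
  - exact: sq_integrableB.
  - have -> : (fun l => nrm3 ((phi m \- phi l) \- (phi m \- u))) =
              (fun l => L2norm Omega (u - phi l)).
      apply/funext => l; congr (nrm3 _); apply/funext => x /=.
      by rewrite -[RHS]/(u x - phi l x); ring.
    exact: cu.
  - move/cvgrPdist_lt : (cb) => /(_ _ eta0); apply: filterS => l.
    rewrite sub0r normrN ger0_norm// => bl.
    have [q1 q2] := ladyzhenskaya oO bO (test_functionB (tphi m) (tphi l)).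
    split; first exact: q1.
    apply: (le_trans q2); rewrite ler_wpM2l// ler_sqr ?nnegrE ?sqr_ge0//.
      apply: (le_trans (energy m l)).
      have bb : b m + b l <= b m + eta by rewrite lerD2l ltW.
      by rewrite ler_sqr// nnegrE addr_ge0// ltW.
    rewrite /test_energy addr_ge0 ?sqr_ge0// sumr_ge0// => i _; exact: sqr_ge0.
split.
  have [q1 _] := bnd 0%N 1 ltr01.
  have [q2 _] := ladyzhenskaya oO bO (tphi 0%N).
  have -> : u = phi 0%N \- (phi 0%N \- u) by apply/funext => x /=; ring.
  exact: quarticB.
apply/cvgrPdist_le => e e0.
(* With b m < eta <= 1 the bound is at most 2 (4 eta^2)^2 <= 2 (4 e / 6)^2 = (8/9) e^2. *)
pose eta := Num.min 1 (e / 6).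
have eta0 : 0 < eta by rewrite lt_min ltr01 divr_gt0.
have eta1 : eta <= 1 by rewrite ge_min lexx.
have etae : eta <= e / 6 by rewrite ge_min lexx orbT.
move/cvgrPdist_lt : (cb) => /(_ _ eta0); apply: filterS => m.
rewrite !sub0r !normrN !ger0_norm ?nrm_ge0// => bm.
have [_ q] := bnd m eta eta0.
rewrite -ler_sqr ?nnegrE ?nrm_ge0 ?(ltW e0)//; apply: (le_trans q).
have h1 : (b m + eta) ^+ 2 <= 4 * eta ^+ 2 by have := b0 m; nra.
have h2 : 4 * eta ^+ 2 <= 4 * (e / 6) by nra.
apply: (@le_trans _ _ (2 * (4 * (e / 6)) ^+ 2)).
  rewrite ler_wpM2l// ler_sqr ?nnegrE ?sqr_ge0//; first exact: le_trans h2.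
  by rewrite mulr_ge0// divr_ge0// ltW.
nra.
Qed.

(* Approximating [w] by test functions [phi], the weak derivative of [a] is
   tested against [phi ^+ 2]. *)
Lemma trilinear_sym (a w : sfield R) i : H10 Omega a -> H10 Omega w ->
  2 * dot3 (w \* a) (wderiv Omega i w) + dot3 (wderiv Omega i a) (w \* w) = 0.
Proof.
move=> ha hw; have [hw1 [phi [tphi cw cdw]]] := hw.
have [qw cqw] := H10_cvg_quartic hw tphi cw cdw.
have qa : quartic3 a.
  have [ha1 [psi [tpsi ca cda]]] := ha.
  by have [] := H10_cvg_quartic ha tpsi ca cda.
have qphi m : quartic3 (phi m) by have [] := ladyzhenskaya oO bO (tphi m).
have sphi m : sqi (phi m) by exact: (test_function_sq_integrable oO bO (tphi m)).
have sdphi m : sqi (pderiv i (phi m)).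
  exact: (test_function_sq_integrable oO bO (test_function_pderiv i (tphi m))).
have sa := H10_sq_integrable ha; have sda := wderiv_sq_integrable i ha.
have sdw := wderiv_sq_integrable i hw.
have E m : 2 * dot3 (phi m \* a) (pderiv i (phi m)) =
           - dot3 (wderiv Omega i a) (phi m \* phi m).
  have [_ /(_ _ (test_functionM (tphi m) (tphi m)))] := is_wderiv_wderiv i ha.1.
  have [sm _ _] := tphi m.
  have dm y : derivable (phi m) y (e3 i) by exact: smooth3_derivable.
  rewrite pderivM//.
  move=> <-; rewrite /dot -RintegralZl//; last first.
    exact: (integrable_mul mO (quartic_mul mO (qphi m) qa) (sdphi m)).
  apply: eq_Rintegral => x _ /=.
  rewrite -[(_ + _) x]/(phi m x * pderiv i (phi m) x + phi m x * pderiv i (phi m) x).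
  ring.
(* Convergence of [phi m] in L^4, with [a] fixed in L^4, gives that of the product in L^2, to be
   paired with derivatives converging in L^2. *)
have c1 : dot3 (phi m \* a) (pderiv i (phi m)) @[m --> \oo]
    --> dot3 (w \* a) (wderiv Omega i w).
  apply: (cvg_dot mO) => //.
  - by move=> m; exact: quartic_mul.
  - exact: quartic_mul.
  - apply: (cvg_nrm_mul mO (g_ := fun=> a)) => //.
    have -> : (fun _ : nat => nrm3 ((a \- a) \* (a \- a))) = (fun=> 0).
      apply/funext => _; rewrite /nrm /dot.
      under eq_Rintegral do rewrite /= subrr !mul0r.
      by rewrite Rintegral_cst// mul0r sqrtr0.
    exact: cvg_cst.
  - have -> : (fun m => nrm3 (pderiv i (phi m) \- wderiv Omega i w)) =
       (fun m => L2norm Omega (wderiv Omega i w - pderiv i (phi m))).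
      by apply/funext => m; exact: nrm_subC.
    exact: cdw.
have c2 : dot3 (wderiv Omega i a) (phi m \* phi m) @[m --> \oo]
    --> dot3 (wderiv Omega i a) (w \* w).
  apply: (cvg_dot mO (f_ := fun=> wderiv Omega i a)) => //.
  - by move=> m; exact: quartic_mul.
  - exact: quartic_mul.
  - have -> : (fun _ : nat => nrm3 (wderiv Omega i a \- wderiv Omega i a)) = (fun=> 0).
      apply/funext => _; rewrite /nrm /dot.
      under eq_Rintegral do rewrite /= subrr !mul0r.
      by rewrite Rintegral_cst// mul0r sqrtr0.
    exact: cvg_cst.
  - exact: (cvg_nrm_mul mO).
have c3 : 2 * dot3 (phi m \* a) (pderiv i (phi m)) @[m --> \oo]
    --> 2 * dot3 (w \* a) (wderiv Omega i w).
  by apply: cvgM => //; exact: cvg_cst.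
rewrite (funext E) in c3.
have c4 : - dot3 (wderiv Omega i a) (phi m \* phi m) @[m --> \oo]
    --> - dot3 (wderiv Omega i a) (w \* w) by exact: cvgN.
have -> : 2 * dot3 (w \* a) (wderiv Omega i w) = - dot3 (wderiv Omega i a) (w \* w).
  by rewrite -(cvg_lim _ c3)// -(cvg_lim _ c4).
by rewrite addNr.
Qed.

(** Half of [trilinear_sym] with a = u_i, summed over i. The component transported is a separate
    scalar [w], so each component of the velocity is treated alone. *)
Lemma NL_component_orthogonal (u : vfield R) (w : sfield R) :
  (forall i, H10 Omega (u i)) -> H10 Omega w ->
  \int[leb3]_(x in Omega) ((\sum_(i < 3) u i x * wderiv Omega i w x
     + 2^-1 * div Omega u x * w x) * w x) = 0.
Proof.
move=> hu hw.
have quart (v : sfield R) : H10 Omega v -> quartic3 v.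
  move=> hv; have [_ [psi [tpsi ca cda]]] := hv.
  by have [] := H10_cvg_quartic hv tpsi ca cda.
have qw := quart _ hw.
pose F i (x : mspace3 R) := (w \* u i) x * wderiv Omega i w x.
pose G i (x : mspace3 R) := wderiv Omega i (u i) x * (w \* w) x.
have iF i : leb3.-integrable Omega (EFin \o F i).
  exact: (integrable_mul mO (quartic_mul mO qw (quart _ (hu i)))
                            (wderiv_sq_integrable i hw)).
have iG i : leb3.-integrable Omega (EFin \o G i).
  exact: (integrable_mul mO (wderiv_sq_integrable i (hu i)) (quartic_mul mO qw qw)).
pose H i (x : mspace3 R) := F i x + 2^-1 * G i x.
have iH i : leb3.-integrable Omega (EFin \o H i).
  exact: (integrableD mO (iF i) (integrableZl mO 2^-1 (iG i))).
have H0 i : \int[leb3]_(x in Omega) H i x = 0.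
  rewrite RintegralD//; last exact: (integrableZl mO 2^-1 (iG i)).
  rewrite RintegralZl//.
  have := trilinear_sym i (hu i) hw; rewrite /dot; lra.
have iH12 : leb3.-integrable Omega (EFin \o (fun x : mspace3 R =>
    H (Ordinal (isT : (1 < 3)%N)) x + H (Ordinal (isT : (2 < 3)%N)) x)).
  exact: (integrableD mO (iH _) (iH _)).
transitivity (\int[leb3]_(x in Omega) (H ord0 x +
  (H (Ordinal (isT : (1 < 3)%N)) x + H (Ordinal (isT : (2 < 3)%N)) x))).
  apply: eq_Rintegral => x _.
  have -> : div Omega u x = \sum_(i < 3) wderiv Omega i (u i) x.
    by rewrite /div fct_sumE.
  have alg (a0 a1 a2 b0 b1 b2 c0 c1 c2 s : R) :
    (a0 * b0 + (a1 * b1 + a2 * b2) + 2^-1 * (c0 + (c1 + c2)) * s) * s =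
    s * a0 * b0 + 2^-1 * (c0 * (s * s)) + (s * a1 * b1 + 2^-1 * (c1 * (s * s))
      + (s * a2 * b2 + 2^-1 * (c2 * (s * s)))) by ring.
  by rewrite 2!sum_ord3; exact: alg.
rewrite (RintegralD mO (iH _) iH12) (RintegralD mO (iH _) (iH _)).
transitivity (0 + (0 + 0) : R); last by rewrite !addr0.
by congr (_ + (_ + _)); exact: H0.
Qed.

Lemma NL_orthogonal (u : vfield R) : (forall i, H10 Omega (u i)) ->
  L2dotv Omega (NL Omega u u) u = 0.
Proof.
move=> hu; rewrite /L2dotv big1// => j _.
exact: NL_component_orthogonal (hu j).
Qed.

End sobolev.

(** * Energy estimate *)

Section bdf2_algebra.
Context d (T : measurableType d) (R : realType).
Variables (mu : {measure set T -> \bar R}) (D : set T).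
Hypothesis mD : measurable D.
Local Notation sqi := (sq_integrable mu D).

Lemma dot_lin (x y : R) (f g h : T -> R) : sqi f -> sqi g -> sqi h ->
  dot mu D ((fun t => x * f t) \- (fun t => y * g t)) h
  = x * dot mu D f h - y * dot mu D g h.
Proof.
move=> sf sg sh.
have sxf := sq_integrableZ mD x sf; have syg := sq_integrableZ mD y sg.
by rewrite dotBl// !dotZl.
Qed.

Lemma dot_lin_sqr (x y : R) (f g : T -> R) : sqi f -> sqi g ->
  let h := (fun t => x * f t) \- (fun t => y * g t) in
  dot mu D h h = x ^+ 2 * dot mu D f f - 2 * (x * y) * dot mu D f g
                 + y ^+ 2 * dot mu D g g.
Proof.
move=> sf sg h.
have sxf := sq_integrableZ mD x sf; have syg := sq_integrableZ mD y sg.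
have sh : sqi h by exact: sq_integrableB.
rewrite [LHS]dot_lin// (dotC mu D f) (dotC mu D g) !dot_lin// (dotC mu D g f).
ring.
Qed.

Lemma bdf2_energy_le (k : R) (a b c f : T -> R) : 0 < k ->
  sqi a -> sqi b -> sqi c -> sqi f ->
  dot mu D a a
  + dot mu D ((fun t => 2 * a t) \- b) ((fun t => 2 * a t) \- b) <=
  dot mu D b b
  + dot mu D ((fun t => 2 * b t) \- c) ((fun t => 2 * b t) \- c)
  + 4 * (3 / 2 * dot mu D a a
         - dot mu D ((fun t => 2 * b t) \- (fun t => 2^-1 * c t)) a
         - k * dot mu D f a)
  + k * dot mu D a a + 4 * k * dot mu D f f.
Proof.
move=> k0 sa sb sc sf.
set P := _ \- b; set Q := _ \- c; set W := _ \- _.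
have one g : g = (fun t => 1 * g t) :> (T -> R).
  by apply/funext => t; rewrite mul1r.
have PE : dot mu D P P = 4 * dot mu D a a - 4 * dot mu D a b + dot mu D b b.
  by rewrite /P [b in _ \- b]one dot_lin_sqr//; ring.
have QE : dot mu D Q a = 2 * dot mu D a b - dot mu D a c.
  by rewrite /Q [c in _ \- c]one dot_lin// !(dotC _ _ _ a); ring.
have SE : dot mu D W a = 2 * dot mu D a b - 2^-1 * dot mu D a c.
  by rewrite /W dot_lin// !(dotC _ _ _ a); ring.
have sQ : sqi Q by apply: sq_integrableB => //; exact: sq_integrableZ.
(* BDF2 is G-stable: the defect is the square of [a - 2 b + c]. *)
have h1 : 0 <= dot mu D a a - 2 * dot mu D Q a + dot mu D Q Q.
  apply: le_trans (dot_ge0 mu D ((fun t => 1 * a t) \- (fun t => 1 * Q t))) _.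
  by rewrite dot_lin_sqr// (dotC _ _ a); lra.
(* Young's inequality for 4 k (f, a), weighted so that |a|^2 gets the coefficient k and |f|^2 gets 4
   k. *)
have h2 : 0 <= k * (4 * dot mu D f f - 4 * dot mu D f a + dot mu D a a).
  rewrite mulr_ge0 ?(ltW k0)//.
  apply: le_trans (dot_ge0 mu D ((fun t => 2 * f t) \- (fun t => 1 * a t))) _.
  by rewrite dot_lin_sqr//; lra.
by move: h1 h2; rewrite PE QE SE; lra.
Qed.
End bdf2_algebra.

(** * Discrete Gronwall inequality and assembly of a time step *)

Lemma gronwall_geometric (R : realType) (k T : R) (E F : nat -> R) :
  0 < k -> k < 1 -> (forall n, 0 <= E n) -> (forall n, 0 <= F n) ->
  (forall n, (1 <= n)%N -> (1 - k) * E n.+1 <= E n + 4 * k * F n.+1) ->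
  forall n, (1 <= n)%N -> n%:R * k <= T ->
  E n <= expR (T / (1 - k)) * (E 1%N + 4 * k * \sum_(2 <= j < n.+1) F j).
Proof.
move=> k0 k1 E0 F0 step n n1 nT.
have q0 : 0 < 1 - k by rewrite subr_gt0.
set q := expR (k / (1 - k)).
have q1 : 1 <= q by rewrite -expR0 ler_expR divr_ge0// ltW.
have qk x : 0 <= x -> x <= q * ((1 - k) * x).
  move=> x0; rewrite mulrA ler_peMl//.
  have : 1 + k / (1 - k) <= q by exact: expR_ge1Dx.
  have -> : 1 + k / (1 - k) = (1 - k)^-1 by field; rewrite gt_eqF.
  by rewrite -[(1 - k)^-1]mul1r ler_pdivrMr.
pose S m := E 1%N + 4 * k * \sum_(2 <= j < m.+1) F j.
have S0 m : 0 <= S m.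
  by rewrite addr_ge0// !mulr_ge0 ?(ltW k0)// sumr_ge0.
(* Only m - 1 steps lead from 1 to m; the spare factor [q] is harmless since q >= 1, for which
   reason each new force term may also be multiplied by a power of [q]. *)
have main m : (1 <= m)%N -> E m <= q ^+ m * S m.
  elim: m => // -[|m] ih _.
    rewrite expr1 /S big_geq// mulr0 addr0 ler_peMl//.
  have hm := ih isT; have st := step m.+1 isT.
  apply: (le_trans (qk _ (E0 _))); rewrite exprS -mulrA ler_pM2l ?expR_gt0//.
  apply: (le_trans st).
  have -> : S m.+2 = S m.+1 + 4 * k * F m.+2.
    by rewrite /S [in LHS]big_nat_recr//= mulrDr addrA.
  rewrite mulrDr lerD// ler_peMl ?exprn_ege1//.
  by rewrite !mulr_ge0// ltW.
apply: (le_trans (main n n1)); rewrite ler_wpM2r ?S0//.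
rewrite -expRM_natl ler_expR mulrA ler_pM2r ?invr_gt0//.
Qed.

(** Testing with the vector u^(n+1) gives an equation for the sum over components only, so the
    scalar inequalities are added with their residuals kept. *)
Lemma sum_energy_le (R : realType) (k : R) (A P B Q W Fa Ff : 'I_3 -> R) :
  (forall i, A i + P i <= B i + Q i + 4 * (3 / 2 * A i - W i - k * Fa i)
                          + k * A i + 4 * k * Ff i) ->
  \sum_(i < 3) A i + \sum_(i < 3) P i <=
  \sum_(i < 3) B i + \sum_(i < 3) Q i
  + 4 * (3 / 2 * \sum_(i < 3) A i - \sum_(i < 3) W i - k * \sum_(i < 3) Fa i)
  + k * \sum_(i < 3) A i + 4 * k * \sum_(i < 3) Ff i.
Proof.
move=> /[dup] /[dup] /(_ ord0) h0 /(_ (Ordinal (isT : (1 < 3)%N))) h1.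
move=> /(_ (Ordinal (isT : (2 < 3)%N))) h2.
rewrite !sum_ord3; lra.
Qed.

(** The residual equals minus the viscous term [g]. Absorbing k A on the left would leave (1 - k) A
    + P; k P is given up as well, so that one factor multiplies the whole energy. *)
Lemma step_bound (R : realType) (k g A P B Q W Fa Ff : R) :
  0 < k -> 0 <= P -> 0 <= g -> 3 / 2 * A + g = W + k * Fa ->
  A + P <= B + Q + 4 * (3 / 2 * A - W - k * Fa) + k * A + 4 * k * Ff ->
  (1 - k) * (A + P) <= B + Q + 4 * k * Ff.
Proof.
move=> k0 P0 g0 e h; have kP : 0 <= k * P by rewrite mulr_ge0// ltW.
lra.
Qed.

Lemma L2dotv_ge0 (R : realType) (I : finType) (Omega : set (space3 R))
    (u : I -> sfield R) : 0 <= L2dotv Omega u u.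
Proof. by rewrite sumr_ge0// => i _; exact: (dot_ge0 leb3 Omega (u i)). Qed.

Lemma sqr_L2normv (R : realType) (I : finType) (Omega : set (space3 R))
    (u : I -> sfield R) : L2normv Omega u ^+ 2 = L2dotv Omega u u.
Proof.
by rewrite sqr_sqrtr// L2dotv_ge0.
Qed.

Theorem theorem3 (R : realType) (Omega : set (space3 R))
    (V : set (vfield R)) (Q : set (sfield R))
    (nu T k : R) (f : R -> vfield R)
    (u : nat -> vfield R) (p : nat -> sfield R) :
  domain3 Omega -> bounded_set Omega ->
  mixed_fem Omega V Q ->
  0 < nu -> 0 < T -> 0 < k -> k < 1 ->
  (forall (n : nat) (i : 'I_3), L2 Omega (f (n%:R * k) i)) ->
  V (u 0%N) -> V (u 1%N) ->
  (forall n : nat, (1 <= n)%N ->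
    [/\ V (u n.+1), Q (p n.+1),
        forall v, V v ->
          3 / 2 * L2dotv Omega (u n.+1) v
          + k * nu * L2dotv Omega (grad Omega (u n.+1)) (grad Omega v)
          + k * L2dotv Omega (NL Omega (u n.+1) (u n.+1)) v
          - k * L2dot Omega (div Omega v) (p n.+1)
          = L2dotv Omega (2 *: u n - 2^-1 *: u n.-1) v
            + k * L2dotv Omega (f (n.+1%:R * k)) v
      & forall q, Q q -> L2dot Omega (div Omega (u n.+1)) q = 0]) ->
  forall n : nat, (2 <= n)%N -> (n%:Z <= Num.floor (T / k)) ->
    L2normv Omega (u n) ^+ 2 + L2normv Omega (2 *: u n - u n.-1) ^+ 2
    <= expR (T / (1 - k))
       * (L2normv Omega (u 1%N) ^+ 2
          + L2normv Omega (2 *: u 1%N - u 0%N) ^+ 2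
          + 4 * k * \sum_(2 <= j < n.+1) L2normv Omega (f (j%:R * k)) ^+ 2).
Proof.
move=> [_ oO _] bO [_ _ VH _ _] nu0 T0 k0 k1 fL2 V0 V1 scheme n n2 nT.
have mO := measurable_domain oO.
have Vu m : V (u m).
  by case: m => [|[|m]] //; have [] := scheme m.+1 isT.
have su m i : sq_integrable leb3 Omega (u m i).
  by apply: (H10_sq_integrable oO); exact: VH (Vu m) i.
have sf m i : sq_integrable leb3 Omega (f (m%:R * k) i).
  by apply: (L2_sq_integrable oO); exact: fL2.
(* At m = 0 the predecessor is 0 again; this value of [E] is never reached, the recursion starting
   from 1. *)
pose E m := L2normv Omega (u m) ^+ 2 + L2normv Omega (2 *: u m - u m.-1) ^+ 2.
apply: (@gronwall_geometric R k T E (fun j => L2normv Omega (f (j%:R * k)) ^+ 2)) => //.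
- by move=> m; rewrite addr_ge0// sqr_ge0.
- by move=> m; exact: sqr_ge0.
- move=> m m1; have [_ Qp mom incomp] := scheme m m1.
  have := mom _ (Vu m.+1).
  (* The momentum equation is tested with [u m.+1], and incompressibility of that same field with q
     = [p m.+1]. *)
  rewrite (NL_orthogonal oO bO (VH _ (Vu m.+1))) (incomp _ Qp) !mulr0 addr0 subr0.
  have kG : 0 <= k * nu * L2dotv Omega (grad Omega (u m.+1)) (grad Omega (u m.+1)).
    by rewrite mulr_ge0 ?L2dotv_ge0 ?mulr_ge0 ?(ltW k0) ?(ltW nu0).
  move=> mom'.
  have en i := bdf2_energy_le mO k0 (su m.+1 i) (su m i) (su m.-1 i) (sf m.+1 i).
  have := sum_energy_le en.
  rewrite /E !sqr_L2normv /= => en3.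
  exact: (step_bound k0 (L2dotv_ge0 _ _) kG mom' en3).
- exact: ltnW.
- by move: nT; rewrite floor_ge_int -ler_pdivlMr.
Qed.
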